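(* Let $\Gamma$ be a finite graph, and let $\sigma=\sigma_\Gamma$. Then the multiplicity of the cographic toric variety $X_\Gamma$ at its torus fixed point $\underline 0$ equals the subdiagram volume of $C(\sigma)$: $$\operatorname{mult}_{\underline 0}X_\Gamma=u(C(\sigma)).$$
   Context: A graph $\Gamma$ consists of a set $V(\Gamma)$ of vertices, a set $\vec E(\Gamma)$ of oriented edges, a fixed-point-free involution $\iota$ of $\vec E(\Gamma)$, and maps $s,t:\vec E(\Gamma)\to V(\Gamma)$ with $s(\vec e)=t(\iota(\vec e))$ (loops and parallel edges allowed). $H_{\mathbb Z}:=\mathbb H_1(\Gamma,\mathbb Z)$ is the kernel of the map $\mathbb Z^{\vec E(\Gamma)}\to\mathbb Z^{V(\Gamma)}$, $\vec e\mapsto t(\vec e)-s(\vec e)$. $\sigma_\Gamma\subset H_{\mathbb R}:=H_{\mathbb Z}\otimes\mathbb R$ is the cone of elements with all coefficients $\ge0$ in the basis $\vec E(\Gamma)$. Put $C(\sigma)=\sigma\cap H_{\mathbb Z}$ and $X_\Gamma=\operatorname{Spec}k[C(\sigma_\Gamma)]$ ($k$ the base field). The point $\underline 0\in X_\Gamma$ corresponds to the maximal ideal spanned by the monomials $X^c$ with $0\ne c\in C(\sigma_\Gamma)$. For a strongly convex rational polyhedral cone $\sigma\subset H_{\mathbb R}$: let $H_{\mathbb R,\sigma}$ be the linear span of $\sigma$ and $H_{\mathbb Z,\sigma}=H_{\mathbb R,\sigma}\cap H_{\mathbb Z}$. Let $\operatorname{vol}_{C(\sigma)}$ be the translation-invariant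 measure on $H_{\mathbb R,\sigma}$ normalized so that the convex hull of $0$ and a $\mathbb Z$-basis of $H_{\mathbb Z,\sigma}$ has volume $1$. Let $K_+(C(\sigma))$ be the convex hull of $C(\sigma)\setminus\{0\}$ and $K_-(C(\sigma))$ the closure of $\sigma\setminus K_+(C(\sigma))$ (the subdiagram part). The subdiagram volume is $u(C(\sigma)):=\operatorname{vol}_{C(\sigma)}(K_-(C(\sigma)))$. *)

(* Defs.v *)
From HB Require Import structures.
From mathcomp Require Import all_boot all_order all_algebra.
From mathcomp Require Import generic_quotient ring_quotient.
From mathcomp Require Import monalg ring.
From mathcomp Require Import all_classical all_reals all_analysis.
Set Implicit Arguments.
Unset Strict Implicit.
Unset Printing Implicit Defensive.
Import Order.TTheory GRing.Theory Num.Theory.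
Import numFieldNormedType.Exports.
Local Open Scope classical_set_scope.
Local Open Scope ring_scope.
Local Open Scope quotient_scope.

Module Localization.
Section Localization.
Variables (A : comNzRingType) (p : prime_idealr A).

Definition denom := {s : A | s \notin (p : pred A)}.
Definition pair := (A * denom)%type.

Definition locequiv (x y : pair) : bool :=
  `[< exists2 u, u \notin (p : pred A) &
      u * (x.1 * sval y.2) = u * (y.1 * sval x.2) >].

Lemma locequiv_refl : reflexive locequiv.
Proof. by move=> x; apply/asboolP; exists 1; rewrite ?idealr1. Qed.

Lemma locequiv_sym : symmetric locequiv.
Proof. by move=> x y; apply/asboolP/asboolP => -[u up e]; exists u. Qed.

Lemma denomM (s t : A) : s \notin (p : pred A) -> t \notin (p : pred A) ->
  s * t \notin (p : pred A).
Proof. by move=> sp tp; rewrite prime_idealrM negb_or sp. Qed.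

Lemma locequiv_trans : transitive locequiv.
Proof.
move=> y x z /asboolP[u up uE] /asboolP[v vp vE]; apply/asboolP.
exists (u * v * sval y.2); first by rewrite !denomM ?(valP y.2).
transitivity (v * sval z.2 * (u * (x.1 * sval y.2))); first by ring.
rewrite uE.
transitivity (u * sval x.2 * (v * (y.1 * sval z.2))); first by ring.
by rewrite vE; ring.
Qed.

Canonical locequiv_equiv :=
  EquivRel locequiv locequiv_refl locequiv_sym locequiv_trans.

Definition type := {eq_quot locequiv}.
HB.instance Definition _ : EqQuotient _ locequiv type := EqQuotient.on type.
HB.instance Definition _ := Choice.on type.

Definition denom1 : denom := Sub 1 (negbT (idealr1 p)).
Definition mulden (s t : denom) : denom :=
  Sub (sval s * sval t) (denomM (valP s) (valP t)).

Definition frac (a : A) (s : denom) : type := \pi_type (a, s).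

Lemma fracP (a b : A) (s t : denom) :
  frac a s = frac b t <->
  exists2 u, u \notin (p : pred A) & u * (a * sval t) = u * (b * sval s).
Proof.
split=> [/eqmodP/asboolP //|e]; apply/eqmodP; exact/asboolP.
Qed.

Lemma fracW (P : type -> Prop) : (forall a s, P (frac a s)) -> forall x, P x.
Proof. by move=> h; elim/quotW => -[a s]; exact: h. Qed.

Definition addf (x y : pair) : pair :=
  (x.1 * sval y.2 + y.1 * sval x.2, mulden x.2 y.2).
Definition oppf (x : pair) : pair := (- x.1, x.2).
Definition mulf (x y : pair) : pair := (x.1 * y.1, mulden x.2 y.2).

Definition add (x y : type) : type := \pi_type (addf (repr x) (repr y)).
Definition opp (x : type) : type := \pi_type (oppf (repr x)).
Definition mul (x y : type) : type := \pi_type (mulf (repr x) (repr y)).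

Lemma reprP (x : pair) : exists2 u, u \notin (p : pred A) &
  u * ((repr (\pi_type x)).1 * sval x.2) =
  u * (x.1 * sval (repr (\pi_type x)).2).
Proof.
have : locequiv (repr (\pi_type x)) x by rewrite -eqmodE reprK.
by move/asboolP.
Qed.

Lemma addE a s b t :
  add (frac a s) (frac b t) = frac (a * sval t + b * sval s) (mulden s t).
Proof.
rewrite /add /frac.
have [u up] := reprP (a, s); have [v vp] := reprP (b, t).
case: (repr (\pi_type (b, t))) => b' t' /= vE.
case: (repr (\pi_type (a, s))) => a' s' /= uE.
apply/fracP; exists (u * v); first exact: denomM.
rewrite /=.
transitivity (v * sval t * sval t' * (u * (a' * sval s)) +
              u * sval s * sval s' * (v * (b' * sval t))); first by ring.
by rewrite uE vE; ring.
Qed.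

Lemma oppE a s : opp (frac a s) = frac (- a) s.
Proof.
rewrite /opp /frac; have [u up] := reprP (a, s).
case: (repr _) => a' s' /= uE.
by apply/fracP; exists u => //=; rewrite !mulNr !mulrN uE.
Qed.

Lemma mulE a s b t : mul (frac a s) (frac b t) = frac (a * b) (mulden s t).
Proof.
rewrite /mul /frac.
have [u up] := reprP (a, s); have [v vp] := reprP (b, t).
case: (repr (\pi_type (b, t))) => b' t' /= vE.
case: (repr (\pi_type (a, s))) => a' s' /= uE.
apply/fracP; exists (u * v); first exact: denomM.
rewrite /=.
transitivity ((u * (a' * sval s)) * (v * (b' * sval t))); first by ring.
by rewrite uE vE; ring.
Qed.

Lemma frac_eq a b (s t : denom) : a * sval t = b * sval s -> frac a s = frac b t.
Proof. by move=> e; apply/fracP; exists 1; rewrite ?idealr1 // e. Qed.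

Let zero := frac 0 denom1.
Let one := frac 1 denom1.

Lemma addA : associative add.
Proof.
elim/fracW => a s; elim/fracW => b t; elim/fracW => c r.
by rewrite !addE; apply: frac_eq => /=; ring.
Qed.

Lemma addC : commutative add.
Proof.
elim/fracW => a s; elim/fracW => b t.
by rewrite !addE; apply: frac_eq => /=; ring.
Qed.

Lemma add0 : left_id zero add.
Proof. by elim/fracW => a s; rewrite addE; apply: frac_eq => /=; ring. Qed.

Lemma addN : left_inverse zero opp add.
Proof.
by elim/fracW => a s; rewrite oppE addE; apply: frac_eq => /=; ring.
Qed.

HB.instance Definition _ := GRing.isZmodule.Build type addA addC add0 addN.

Lemma mulA : associative mul.
Proof.
elim/fracW => a s; elim/fracW => b t; elim/fracW => c r.
by rewrite !mulE; apply: frac_eq => /=; ring.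
Qed.

Lemma mulC : commutative mul.
Proof.
elim/fracW => a s; elim/fracW => b t.
by rewrite !mulE; apply: frac_eq => /=; ring.
Qed.

Lemma mul1 : left_id one mul.
Proof. by elim/fracW => a s; rewrite mulE; apply: frac_eq => /=; ring. Qed.

Lemma mulDl : left_distributive mul add.
Proof.
elim/fracW => a s; elim/fracW => b t; elim/fracW => c r.
by rewrite !(addE, mulE); apply: frac_eq => /=; ring.
Qed.

Lemma one_neq0 : one != zero.
Proof.
apply/eqP => /fracP[u up] /=; rewrite !mulr1 mulr0 => u0.
by move: up; rewrite u0 idealr0.
Qed.

HB.instance Definition _ :=
  GRing.Zmodule_isComNzRing.Build type mulA mulC mul1 mulDl one_neq0.

Lemma fracD a s b t :
  frac a s + frac b t = frac (a * sval t + b * sval s) (mulden s t).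
Proof. exact: addE. Qed.

Lemma fracN a s : - frac a s = frac (- a) s.
Proof. exact: oppE. Qed.

Lemma fracM a s b t : frac a s * frac b t = frac (a * b) (mulden s t).
Proof. exact: mulE. Qed.

Lemma frac0 : frac 0 denom1 = 0. Proof. by []. Qed.

Lemma frac1 : frac 1 denom1 = 1. Proof. by []. Qed.

End Localization.
End Localization.
HB.export Localization.

Notation localization := Localization.type.

Section Multiplicity.
Variable O : comNzRingType.

(* not necessarily proper, unlike idealr *)
Definition is_ideal (I : set O) : Prop :=
  [/\ I 0, forall x y, I x -> I y -> I (x + y) & forall a x, I x -> I (a * x)].

Definition ideal_pow (I : set O) (n : nat) : set O :=
  [set x | exists (m : nat) (a : 'I_m -> O) (y : 'I_m -> 'I_n -> O),
     (forall j i, I (y j i)) /\ x = \sum_(j < m) a j * \prod_(i < n) y j i].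

(* Submodules of O / J are represented by the ideals of O containing J. *)
Definition ideal_chain (J : set O) (r : nat) (I : nat -> set O) : Prop :=
  [/\ J `<=` I 0%N,
      forall i, (i <= r)%N -> is_ideal (I i) &
      forall i, (i < r)%N -> I i `<` I i.+1].

(* the O-module O / J has finite length l *)
Definition quotient_length (J : set O) (l : nat) : Prop :=
  (exists I, ideal_chain J l I) /\
  (forall r I, ideal_chain J r I -> (r <= l)%N).

Definition nonunits : set O := [set x | ~ exists y, x * y = 1].

Definition hilbert_samuel_poly : {poly rat} :=
  xget 0 [set P : {poly rat} | \forall n \near \oo,
    exists2 l, quotient_length (ideal_pow nonunits n) l & P.[n%:R] = l%:R].

(* For a local ring O, where nonunits is the maximal ideal: the integer e such
   that the Hilbert-Samuel polynomial has leading term e n^d / d!. *)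
Definition multiplicity : rat :=
  ((size hilbert_samuel_poly).-1)`!%:R * lead_coef hilbert_samuel_poly.

End Multiplicity.

(* mult_x (Spec A), for x the point given by the prime ideal p *)
Definition mult_at (A : comNzRingType) (p : prime_idealr A) : rat :=
  multiplicity (localization p).

Section TupleLebesgue.
Variable R : realType.

Notation Rn n := (n.-tuple (measurableTypeR R)).

Section Cons.
Variable n : nat.

Definition cons_pair (x : measurableTypeR R * Rn n) : Rn n.+1 :=
  [tuple of x.1 :: x.2].

Lemma measurable_cons_pair : measurable_fun [set: _] cons_pair.
Proof. exact: (measurable_cons measurable_fst measurable_snd). Qed.

Definition uncons (t : Rn n.+1) : measurableTypeR R * Rn n :=
  (thead t, [tuple of behead t]).

Lemma measurable_uncons : measurable_fun [set: _] uncons.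
Proof.
apply/measurable_fun_pairP; split.
- exact: measurable_tnth.
- exact: measurable_behead.
Qed.

Lemma cons_pairK : cancel cons_pair uncons.
Proof. by case=> x t; rewrite /uncons /cons_pair theadE; congr (_, _); exact/val_inj. Qed.

Variable mu : {sigma_finite_measure set (Rn n) -> \bar R}.

Definition cons_measure : set (Rn n.+1) -> \bar R :=
  pushforward (lebesgue_measure \x mu)%E cons_pair.

Let cons_measure0 : cons_measure set0 = 0%E.
Proof. by rewrite /cons_measure /pushforward preimage_set0 measure0. Qed.

Let cons_measure_ge0 A : (0 <= cons_measure A)%E.
Proof. by rewrite /cons_measure /pushforward measure_ge0. Qed.

Let cons_measure_sigma_additive : semi_sigma_additive cons_measure.
Proof.
move=> F mF tF mUF; rewrite /cons_measure /pushforward preimage_bigcup.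
apply: measure_semi_sigma_additive.
- by move=> i; rewrite -[X in measurable X]setTI; exact: measurable_cons_pair.
- apply/trivIsetP => i j _ _ ij; rewrite -preimage_setI.
  by move/trivIsetP : tF => ->//; rewrite preimage_set0.
- by rewrite -preimage_bigcup -[X in measurable X]setTI;
    exact: measurable_cons_pair.
Qed.

HB.instance Definition _ := isMeasure.Build _ _ _ cons_measure
  cons_measure0 cons_measure_ge0 cons_measure_sigma_additive.

Let cons_measure_sigma_finite : sigma_finite setT cons_measure.
Proof.
have /sigma_finiteP[F [FT ndF Foo]] := sigma_finiteT (@lebesgue_measure R).
have /sigma_finiteP[H [HT ndH Hoo]] := sigma_finiteT mu.
exists (fun i => uncons @^-1` (F i `*` H i)).
  rewrite -preimage_bigcup -(preimage_setT uncons); congr (_ @^-1` _).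
  rewrite -setXTT FT HT predeqE => -[x y]; split.
    move=> [/= [i _ Fix] [j _ Hjy]]; exists (maxn i j) => //; split.
    - by move: x Fix; exact/subsetPset/ndF/leq_maxl.
    - by move: y Hjy; exact/subsetPset/ndH/leq_maxr.
  by move=> [i _ []/= ? ?]; split; exists i.
move=> i; have [mF Fi] := Foo i; have [mH Hi] := Hoo i; split.
  by rewrite -[X in measurable X]setTI; apply: measurable_uncons => //;
    exact: measurableX.
rewrite /cons_measure /pushforward -comp_preimage.
rewrite (_ : uncons \o cons_pair = id); last exact/funext/cons_pairK.
by rewrite preimage_id product_measure1E// lte_mul_pinfty// ge0_fin_numE.
Qed.

HB.instance Definition _ := Measure_isSigmaFinite.Build _ _ _ cons_measure
  cons_measure_sigma_finite.

End Cons.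

Fixpoint tuple_lebesgue (n : nat) :
    {sigma_finite_measure set (Rn n) -> \bar R} :=
  match n with
  | 0 => \d_([tuple] : Rn 0)
  | n'.+1 => cons_measure (tuple_lebesgue n')
  end.

End TupleLebesgue.

Import ArrowAsProduct.

Section SubdiagramVolume.
Variables (R : realType) (I : finType).

Notation VZ := {ffun I -> int}.
Notation VR := (I -> R).

Definition realify (z : VZ) : VR := fun i => (z i)%:~R.

Definition lincomb (n : nat) (a : 'I_n -> R) (v : 'I_n -> VR) : VR :=
  fun i => \sum_(j < n) a j * v j i.

Definition linear_span (A : set VR) : set VR :=
  [set x | exists n (a : 'I_n -> R) (v : 'I_n -> VR),
     (forall j, A (v j)) /\ x = lincomb a v].

Definition convex_hull (A : set VR) : set VR :=
  [set x | exists n (a : 'I_n -> R) (v : 'I_n -> VR),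
     [/\ forall j, A (v j), forall j, 0 <= a j, \sum_(j < n) a j = 1 &
         x = lincomb a v]].

Definition is_Zbasis (L : set VZ) (b : seq VZ) : Prop :=
  {in b, forall z, L z} /\
  forall z, L z ->
    exists! c : 'I_(size b) -> int, z = \sum_(j < size b) b`_j *~ c j.

Definition Zbasis (L : set VZ) : seq VZ := xget [::] [set b | is_Zbasis L b].

Definition basis_comb (b : seq VZ)
    (t : (size b).-tuple (measurableTypeR R)) : VR :=
  lincomb (tnth t) (fun j => realify b`_j).

(* The image on the real span of L of Lebesgue measure on R^d, d = rank L,
   scaled so that the convex hull of 0 and a Z-basis of L has volume 1; another
   Z-basis differs by an element of GL_d(Z), hence gives the same measure. *)
Definition lattice_volume (L : set VZ) (A : set VR) : \bar R :=
  let b := Zbasis L in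
  let leb A := tuple_lebesgue R (size b) (@basis_comb b @^-1` A) in
  let simplex := convex_hull (realify @` (0 |` [set` b])) in
  (leb A / leb simplex)%E.

Variables (H : set VZ) (sigma : set VR).

Definition lattice_points : set VZ := [set z | H z /\ sigma (realify z)].

Definition span_lattice : set VZ :=
  [set z | H z /\ linear_span sigma (realify z)].

Definition Kplus : set VR :=
  convex_hull (realify @` (lattice_points `\ 0)).

(* The closure is taken in I -> R with the product topology; it agrees with the
   closure in the linear span of sigma, which is closed. *)
Definition Kminus : set VR := closure (sigma `\` Kplus).

Definition subdiagram_volume : \bar R := lattice_volume span_lattice Kminus.

End SubdiagramVolume.

Record graph := Graph {
  vertex : finType;
  oedge : finType;
  einv : oedge -> oedge;
  src : oedge -> vertex;
  tgt : oedge -> vertex;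
  einvK : involutive einv;
  einv_neq : forall e, einv e != e;
  src_tgt : forall e, src e = tgt (einv e)
}.

Section Cographic.
Variables (R : realType) (k : fieldType) (G : graph).

Definition boundary (z : {ffun oedge G -> int}) : {ffun vertex G -> int} :=
  [ffun v => \sum_(e : oedge G) z e * ((tgt e == v)%:R - (src e == v)%:R)].

Definition homology : set {ffun oedge G -> int} := [set z | boundary z = 0].

(* H_Z tensored with R, realized as the real span of H_Z in R^E *)
Definition real_homology : set (oedge G -> R) :=
  linear_span (@realify R _ @` homology).

Definition cographic_cone : set (oedge G -> R) :=
  [set x | real_homology x /\ forall e, 0 <= x e].

Definition cographic_semigroup :=
  {z : {ffun oedge G -> int} | z \in lattice_points homology cographic_cone}.

HB.instance Definition _ := Choice.on cographic_semigroup.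

Lemma cographic_pointsP z :
  lattice_points homology cographic_cone z <->
  boundary z = 0 /\ forall e, 0 <= z e.
Proof.
split=> [[Hz [_ z0]]|[Hz z0]].
  by split=> // e; move: (z0 e); rewrite ler0z.
split=> //; split=> [|e]; last by rewrite ler0z.
exists 1%N, (fun=> 1), (fun=> realify R z); split=> [_|]; first by exists z.
by apply/funext => e; rewrite /lincomb big_ord1 mul1r.
Qed.

Lemma boundaryD z w : boundary (z + w) = boundary z + boundary w.
Proof.
apply/ffunP => v; rewrite !ffunE -big_split; apply: eq_bigr => e _ /=.
by rewrite ffunE mulrDl.
Qed.

Let add0_subproof : 0 \in lattice_points homology cographic_cone.
Proof.
apply/mem_set/cographic_pointsP; split=> [|e]; last by rewrite ffunE.
by apply/ffunP => v; rewrite !ffunE big1 // => e _; rewrite ffunE mul0r.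
Qed.

Let add_subproof (z w : cographic_semigroup) :
  sval z + sval w \in lattice_points homology cographic_cone.
Proof.
have /set_mem/cographic_pointsP[Hz z0] := valP z.
have /set_mem/cographic_pointsP[Hw w0] := valP w.
apply/mem_set/cographic_pointsP; split=> [|e].
  by rewrite boundaryD Hz Hw addr0.
by rewrite ffunE addr_ge0.
Qed.

Definition semigroup0 : cographic_semigroup := Sub 0 add0_subproof.
Definition semigroupD (z w : cographic_semigroup) : cographic_semigroup :=
  Sub (sval z + sval w) (add_subproof z w).

Let semigroupA : associative semigroupD.
Proof. by move=> x y z; apply: val_inj; rewrite /= addrA. Qed.

Let semigroup0D : left_id semigroup0 semigroupD.
Proof. by move=> x; apply: val_inj; rewrite /= add0r. Qed.

Let semigroupD0 : right_id semigroup0 semigroupD.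
Proof. by move=> x; apply: val_inj; rewrite /= addr0. Qed.

Let semigroup_unit (x y : cographic_semigroup) :
  semigroupD x y = semigroup0 -> x = semigroup0 /\ y = semigroup0.
Proof.
move=> /(congr1 sval) /ffunP xy0.
have /set_mem/cographic_pointsP[_ x0] := valP x.
have /set_mem/cographic_pointsP[_ y0] := valP y.
split; apply/val_inj/ffunP => e /=; move/eqP: (xy0 e);
  by rewrite !ffunE paddr_eq0 // => /andP[/eqP ? /eqP ?].
Qed.

Let semigroupC : commutative semigroupD.
Proof. by move=> x y; apply: val_inj; rewrite /= addrC. Qed.

HB.instance Definition _ := Choice_isMonomialDef.Build cographic_semigroup
  semigroupA semigroup0D semigroupD0 semigroup_unit.
HB.instance Definition _ := MonomialDef_isConomialDef.Build cographic_semigroup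
  semigroupC.

Definition cographic_ring : comNzRingType := {malg k[cographic_semigroup]}.

(* The monoid law being written multiplicatively, mone is 0 in C(sigma): these are
   the elements without constant term, i.e. the k-span of the X^c, c <> 0. *)
Definition origin : {pred cographic_ring} :=
  [pred f : {malg k[cographic_semigroup]} | mcoeff mone f == 0].

Lemma originE (f : cographic_ring) :
  (f \in origin) = (mcoeff mone (f : {malg k[cographic_semigroup]}) == 0).
Proof. by []. Qed.

Let origin_ideal : idealr_closed origin.
Proof.
split=> [||a f g]; rewrite !originE ?rmorph0 ?rmorph1 ?oner_eq0 //.
by move=> /eqP f0 /eqP g0; rewrite rmorphD rmorphM /= f0 g0 mulr0 addr0.
Qed.

Let origin_prime : prime_idealr_closed origin.
Proof. by move=> f g; rewrite !originE rmorphM mulf_eq0. Qed.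

HB.instance Definition _ := isIdealr.Build cographic_ring origin origin_ideal.
HB.instance Definition _ :=
  isPrimeIdealrClosed.Build cographic_ring origin origin_prime.

End Cographic.

Arguments homology : clear implicits.
Arguments cographic_cone : clear implicits.
Arguments cographic_ring : clear implicits.
Arguments origin : clear implicits.

(* Main.v *)
Require Import Defs.
From mathcomp Require Import all_boot all_order all_algebra.
From mathcomp Require Import generic_quotient ring_quotient.
From mathcomp Require Import monalg zify ring lra.
From mathcomp Require Import all_classical all_reals all_analysis.
Set Implicit Arguments.
Unset Strict Implicit.
Unset Printing Implicit Defensive.
Import Order.TTheory GRing.Theory Num.Theory.
Import numFieldNormedType.Exports.
Local Open Scope ring_scope.

(** Write C for the semigroup of nonnegative integral circulations, M for C
    without 0, and g_1, ..., g_N for the circulations in M with coefficients 0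
    and 1. Every nonzero nonnegative circulation, integral or real, has such a
    g_i supported where it is positive, and subtracting multiples of these
    shows that the g_i generate C as a semigroup and sigma as a cone
    ([circulation_combination], [sigma_heavy]).

    Algebra. Let O be the local ring at the origin and m its maximal ideal.
    A monomial X^c lies in m^n exactly when c is a sum of n elements of M and
    an element of C. The length of O/m^n is therefore the number h(n) of the c
    in C that are not such sums: a chain of ideals above m^n cannot be longer
    by linear algebra on these monomials, and adding them one at a time by
    decreasing degree gives a chain of that length ([quotient_length_monom]).
    Choosing for each c the best of its writings as a sum of the g_i (longest,
    then lexicographically least) turns h(n) into a count of exponent vectors
    in a set closed under passing to smaller vectors, and such counts are
    eventually polynomial by Dickson's lemma ([eventually_poly_short_sums]).

    Geometry. For x in sigma let phi(x) be the largest value of the sum of the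
    a_i over all writings of x as the sum of the a_i g_i with a_i >= 0. Then phi
    is homogeneous and superadditive, and K_+ is the set where phi >= 1
    ([Kplus_heavy], [heavy_Kplus]). If c is a sum of n elements of M then
    phi(c) >= n; conversely, rounding the a_i down shows that phi(c) >= n + N
    makes c such a sum ([heavy_long_sum]). So h(n) counts lattice points of
    n K_-, up to a bounded error in the level of phi.

    Counting. Cut the space into cubes of side 1/n with corners in the lattice
    scaled by 1/n. Where the count and K_- disagree, the cube straddles the
    boundary of sigma or a layer of phi of bounded width. Moving along a lattice
    vector w deep inside sigma leaves both regions for good. Hence many
    translates of either set of exceptional cubes by multiples of w are
    disjoint, while all fit into a box of size proportional to n, and there are
    only o(n^d) exceptional cubes ([thin_count]). This yields h(n)/n^d -> V, the
    volume of K_- in the coordinates of a Z-basis ([lattice_count_cvg],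
    [short_points_cvg]). The same count for the standard simplex, with its
    'C(n + d, d) points, gives the volume 1/d! ([simplex_volume]).

    As V > 0, a polynomial that agrees with h(n) for large n has degree d and
    leading coefficient V ([poly_of_cvg]), so the multiplicity is d! V, which
    is the ratio of the two volumes. *)

(** * Counting exponent vectors in a downset *)

Fixpoint compositions (N n : nat) : seq (seq nat) :=
  if N is N'.+1
  then [seq j :: s | j <- iota 0 n.+1, s <- compositions N' (n - j)]
  else if n == 0 then [:: [::]] else [::].

Lemma compositionsS N n : compositions N.+1 n =
  [seq j :: s | j <- iota 0 n.+1, s <- compositions N (n - j)].
Proof. by []. Qed.

Lemma mem_compositions N n s :
  (s \in compositions N n) = (size s == N) && (sumn s == n).
Proof.
elim: N n s => [|N IH] n s.
  by case: s => [|a s]; case: n => [|n].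
rewrite compositionsS.
apply/allpairsPdep/andP => [[j [t [jn tn ->]]]|].
  rewrite mem_iota add0n ltnS /= in jn; rewrite IH in tn.
  by case/andP: tn => /eqP sN /eqP tE; rewrite /= sN tE subnKC ?eqxx.
case: s => [|a s] [] // sN /eqP <-; exists a, s; split => //.
  by rewrite mem_iota add0n /= ltnS leq_addr.
by rewrite IH addKn eqxx andbT.
Qed.

Lemma compositions_uniq N n : uniq (compositions N n).
Proof.
elim: N n => [|N IH] n; first by rewrite /=; case: (n == 0)%N.
rewrite compositionsS.
apply: allpairs_uniq_dep => [|j _|]; rewrite ?iota_uniq //.
by move=> [j s] [j' s'] _ _ /= [-> ->].
Qed.

Lemma count_compositionsS (P : pred (seq nat)) N n :
  count P (compositions N.+1 n) =
  (\sum_(0 <= j < n.+1) count (fun s => P (j :: s)) (compositions N (n - j)))%N.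
Proof.
rewrite compositionsS count_flatten sumnE big_map big_map /index_iota subn0.
by apply: eq_bigr => j _; rewrite count_map.
Qed.

Definition downset (P : pred (seq nat)) :=
  forall s t, all2 leq s t -> P t -> P s.

Lemma all2_leqxx s : all2 leq s s.
Proof. by elim: s => //= a s ->; rewrite leqnn. Qed.

(** The complement of a downset is generated, as an upper set, by finitely many
    vectors: the form in which Dickson's lemma is used. *)
Definition finitely_excluded (N : nat) (P : pred (seq nat)) :=
  exists F : seq (seq nat), {in F, forall f, ~~ P f} /\
    forall s, size s = N -> ~~ P s -> exists2 f, f \in F & all2 leq f s.

(** The intersection of the chain is again a downset. Each of the finitely many
    generators of its complement has left the chain at some stage, and at the
    last of these stages the chain has reached its intersection. *)
Lemma chain_stable N (P : nat -> pred (seq nat)) :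
  (forall Q, downset Q -> finitely_excluded N Q) ->
  (forall j, downset (P j)) -> (forall i j s, (i <= j)%N -> P j s -> P i s) ->
  exists J, forall j s, (J <= j)%N -> size s = N -> P j s = P J s.
Proof.
move=> fin dP PS.
have dPoo : downset (fun s => `[< forall j, P j s >]).
  move=> s t st /asboolP Pt; apply/asboolP => j; exact: dP (Pt j).
have [F [F1 F2]] := fin _ dPoo.
have [J HJ] : exists J, {in F, forall f, ~~ P J f}.
  elim: (F) F1 => [|f F' IHF] FF; first by exists 0.
  have [|J HJ] := IHF; first by move=> g gF; apply: FF; rewrite inE gF orbT.
  have /asboolPn/existsNP[j /negP Pj] := FF f (mem_head _ _).
  exists (maxn j J) => g; rewrite inE => /orP[/eqP ->|gF].
    by apply: contra Pj; apply: PS; rewrite leq_maxl.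
  by apply: contra (HJ g gF); apply: PS; rewrite leq_maxr.
exists J => j s Jj sN; apply/idP/idP; first exact: PS.
apply: contraLR => nP; have [|f fF fs] := F2 s sN.
  by apply/asboolPn => /(_ j) Pj; rewrite Pj in nP.
by apply: contra (HJ f fF); apply: dP.
Qed.

Definition slice (P : pred (seq nat)) (j : nat) : pred (seq nat) :=
  fun s => P (j :: s).

Lemma slice_downset P j : downset P -> downset (slice P j).
Proof. by move=> dP s t st; apply: dP => /=; rewrite leqnn. Qed.

Lemma slice_decreasing P i j s : downset P -> (i <= j)%N ->
  slice P j s -> slice P i s.
Proof. by move=> dP ij; apply: dP => /=; rewrite ij all2_leqxx. Qed.

(** Induction on the number of coordinates: the slices at a fixed first
    coordinate decrease, hence are constant from some J on, and generators of
    the complements of the slices 0, ..., J, with their first coordinate put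
    back, generate the complement of the whole. *)
Lemma dickson N P : downset P -> finitely_excluded N P.
Proof.
elim: N P => [|N IH] P dP.
  exists (if P [::] then [::] else [:: [::]]); case: (boolP (P [::])) => Pn.
    by split=> // s /size0nil ->; rewrite Pn.
  split=> [f|s /size0nil -> _]; first by rewrite inE => /eqP ->.
  by exists [::]; rewrite ?inE.
have dQ j := @slice_downset P j dP.
have [J HJ] := chain_stable IH dQ (fun i j s => @slice_decreasing P i j s dP).
have [F FP] := choice (fun j => IH _ (dQ j)).
exists [seq j :: f | j <- iota 0 J.+1, f <- F j]; split.
  by move=> s /allpairsPdep[j [f [_ fF ->]]]; apply: (FP j).1.
move=> [//|j s] [sN] nP.
have [|f fF fs] := (FP (minn j J)).2 s sN.
  by case: (leqP j J) => [//|/ltnW Jj]; rewrite -(HJ j s Jj sN).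
exists (minn j J :: f); last by rewrite /= geq_minl.
by apply/allpairsPdep; exists (minn j J), f; split;
   rewrite // mem_iota /= add0n ltnS geq_minr.
Qed.

Definition eventually_poly (f : nat -> nat) := exists (Q : {poly rat}) (n0 : nat),
  forall n, (n0 <= n)%N -> (f n)%:R = Q.[n%:R].

Lemma eventually_poly_eq f g : (exists n0, forall n, (n0 <= n)%N -> f n = g n) ->
  eventually_poly f -> eventually_poly g.
Proof.
move=> [m fg] [Q [n0 fQ]]; exists Q, (maxn m n0) => n.
by rewrite geq_max => /andP[mn n0n]; rewrite -fg // fQ.
Qed.

Lemma eventually_polyD f g : eventually_poly f -> eventually_poly g ->
  eventually_poly (fun n => f n + g n)%N.
Proof.
move=> [P [m fP]] [Q [n gQ]]; exists (P + Q), (maxn m n) => i.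
by rewrite geq_max => /andP[mi ni]; rewrite natrD hornerD fP // gQ.
Qed.

Lemma eventually_poly_big (I : Type) (r : seq I) (f : I -> nat -> nat) :
  (forall i, eventually_poly (f i)) ->
    eventually_poly (fun n => \sum_(i <- r) f i n)%N.
Proof.
move=> fP; elim: r => [|i r IH].
  by exists 0, 0 => n _; rewrite big_nil horner0.
apply: eventually_poly_eq (eventually_polyD (fP i) IH).
by exists 0 => n _; rewrite big_cons.
Qed.

Lemma eventually_poly_shift f j : eventually_poly f ->
  eventually_poly (fun n => f (n - j)%N).
Proof.
move=> [P [m fP]]; exists (P \Po ('X - j%:R%:P)), (m + j)%N => n mn.
by rewrite fP ?horner_comp ?hornerE ?natrB//; lia.
Qed.

(** The difference operator lowers the degree by exactly one, multiplying the
    leading coefficient by the degree, so leading terms can be removed one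
    after the other. *)
Lemma poly_primitive (Q : {poly rat}) :
  exists S : {poly rat}, forall x, S.[x + 1] - S.[x] = Q.[x].
Proof.
have [n] := ubnP (size Q); elim: n Q => // n IH Q; rewrite ltnS => szQ.
case: (eqVneq Q 0) => [->|Q0].
  by exists 0 => x; rewrite !horner0 subr0.
have sQ : (size Q > 0)%N by rewrite size_poly_gt0.
set k := (size Q).-1; have kE : size Q = k.+1 by rewrite prednK.
(* T is the difference of a monomial; it has the leading term of Q. *)
pose T : {poly rat} := (lead_coef Q / k.+1%:R) *: (1 + 'X)^+k.+1
                     - (lead_coef Q / k.+1%:R) *: 'X^(k.+1).
have TE : T = \sum_(i < k.+1) ((lead_coef Q / k.+1%:R) * 'C(k.+1, i)%:R) *: 'X^i.
  rewrite /T exprDn big_ord_recr /= subnn expr0 mul1r ?expr1n binn scalerDr.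
  rewrite ?mulr1 ?mulr1n addrK scaler_sumr; apply: eq_bigr => i _.
  by rewrite expr1n mul1r -scaler_nat scalerA.
have [|S SP] := IH (Q - T).
  apply: leq_trans szQ; rewrite kE ltnS; apply/leq_sizeP => j kj.
  rewrite coefB TE coef_sum.
  case: (ltngtP k j) => [{}kj|jk|<-]; last 2 first.
  - by rewrite ltnNge kj in jk.
  - rewrite big_ord_recr /= big1 => [|i _].
      rewrite coefZ coefXn eqxx mulr1 binSn add0r divfK ?pnatr_eq0 //.
      by rewrite lead_coefE subrr.
    by rewrite coefZ coefXn gtn_eqF ?mulr0.
  rewrite nth_default ?kE // sub0r big1 ?oppr0 // => i _.
  by rewrite coefZ coefXn gtn_eqF ?mulr0 // (leq_trans (ltn_ord i)).
exists (S + (lead_coef Q / k.+1%:R) *: 'X^(k.+1)) => x.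
have -> : Q.[x] = S.[x + 1] - S.[x] + T.[x].
  by rewrite SP -hornerD subrK.
rewrite /T !(hornerE, hornerXn, horner_exp) [1 + x]addrC /=; ring.
Qed.

Lemma eventually_poly_sum f : eventually_poly f ->
  eventually_poly (fun n => \sum_(0 <= i < n) f i)%N.
Proof.
move=> [Q [m fQ]]; have [S SP] := poly_primitive Q.
exists (S + ((\sum_(0 <= i < m) f i)%N%:R - S.[m%:R])%:P), m => n /subnK <-.
elim: (n - m)%N => [|i IH]; first by rewrite add0n hornerD hornerC addrC subrK.
rewrite addSn big_nat_recr // natrD IH fQ ?leq_addl // -SP -natr1 !hornerD !hornerC.
by rewrite [LHS]addrC addrA subrK.
Qed.

(** Sort the vectors by their first coordinate j. From some J on all slices
    agree, so the count of total n is a finite sum of counts in one dimension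
    less, plus a sum over all totals up to n - J of a single such count. *)
Lemma eventually_poly_downset N (P : pred (seq nat)) : downset P ->
  eventually_poly (fun n => count P (compositions N n)).
Proof.
elim: N P => [|N IH] P dP.
  by exists 0, 1%N => -[|n] //= _; rewrite horner0.
pose Q := slice P; have dQ j : downset (Q j) by apply: slice_downset.
have [J HJ] := chain_stable (@dickson N) dQ (fun i j s =>
  @slice_decreasing P i j s dP).
have e1 := eventually_poly_big (index_iota 0 J) (fun j =>
  eventually_poly_shift j (IH _ (dQ j))).
have e2 := eventually_poly_shift J (eventually_poly_sum (IH _ (dQ J))).
have e3 := IH _ (dQ J).
apply: eventually_poly_eq (eventually_polyD e1 (eventually_polyD e2
  (eventually_poly_shift J e3))).
exists J => n Jn; rewrite count_compositionsS.
rewrite [RHS](big_cat_nat (n := J)) //=; last by lia.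
congr addn; transitivity (\sum_(0 <= i < (n - J).+1) count (Q J) (compositions N
  i))%N.
  by rewrite big_nat_recr.
rewrite big_nat_rev /= add0n [RHS](big_addn 0 n.+1 J) subSn //.
rewrite big_nat_cond [RHS]big_nat_cond; apply: eq_bigr => i.
rewrite andbT ltnS => /andP[_ iJ]; rewrite subSS subnDAC -subnDA addnC subnDA.
by apply: eq_in_count => s; rewrite mem_compositions => /andP[/eqP sN _];
   apply/esym/HJ; rewrite ?leq_addl.
Qed.

(** * Elements that are not long sums *)

Definition addseq (s t : seq nat) := [seq (p.1 + p.2)%N | p <- zip s t].

Lemma size_addseq s t : size s = size t -> size (addseq s t) = size t.
Proof. by move=> st; rewrite size_map size2_zip ?st. Qed.

Lemma sumn_addseq s t : size s = size t ->
  sumn (addseq s t) = (sumn s + sumn t)%N.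
Proof.
elim: s t => [|a s IH] [|b t] //= [st].
by rewrite -/(addseq s t) IH // addnACA.
Qed.

Lemma nth_addseq s t i : size s = size t ->
  nth 0%N (addseq s t) i = (nth 0%N s i + nth 0%N t i)%N.
Proof.
elim: s t i => [|a s IH] [|b t] [|i] //= [st].
by rewrite -/(addseq s t) IH.
Qed.

Lemma all2_leq_addseq s t : all2 leq s t ->
  exists u, size s = size u /\ t = addseq s u.
Proof.
elim: s t => [|a s IH] [|b t] //= => [_|/andP[ab /IH[u [su tE]]]];
  first by exists [::].
exists ((b - a)%N :: u); split; first by rewrite /= su.
by rewrite [addseq _ _]/(addseq (a :: s) (b - a :: u)%N) /addseq /= subnKC // tE.
Qed.

Fixpoint lexlt (s t : seq nat) := match s, t with
  | a :: s', b :: t' => (a < b)%N || (a == b) && lexlt s' t'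
  | _, _ => false
  end.

(** A total order on exponent vectors of equal length: longer sums first, then
    the lexicographically smaller ones. *)
Definition better (s t : seq nat) :=
  (sumn t < sumn s)%N || (sumn t == sumn s) && lexlt s t.

Lemma lexlt_total s t : size s = size t -> s != t -> lexlt s t || lexlt t s.
Proof.
elim: s t => [|a s IH] [|b t] //= [st]; rewrite eqseq_cons.
by case: ltngtP => //= _; apply: IH.
Qed.

Lemma lexlt_irr s : lexlt s s = false.
Proof. by elim: s => //= a s ->; rewrite ltnn eqxx. Qed.

Lemma lexlt_trans t s u : lexlt s t -> lexlt t u -> lexlt s u.
Proof.
elim: s t u => [|a s IH] [|b t] [|c u] //=.
case/orP => [ab|/andP[/eqP <- st]] /orP[bc|/andP[/eqP <- tu]].
- by rewrite (ltn_trans ab bc).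
- by rewrite ab.
- by rewrite bc.
- by rewrite eqxx (IH _ _ st tu) orbT.
Qed.

(** Compatibility with addition is what makes the best representatives below
    form a downset. *)
Lemma lexlt_addseq s t u : size s = size u -> size t = size u ->
  lexlt s t -> lexlt (addseq s u) (addseq t u).
Proof.
elim: s t u => [|a s IH] [|b t] [|c u] //= [su] [tu].
rewrite ltn_add2r eqn_add2r => /orP[->//|/andP[-> /= st]].
by rewrite [lexlt _ _]IH ?orbT.
Qed.

Lemma better_irr s : better s s = false.
Proof. by rewrite /better ltnn lexlt_irr andbF. Qed.

Lemma better_trans t s u : better s t -> better t u -> better s u.
Proof.
rewrite /better => /orP[st|/andP[/eqP e st]] /orP[tu|/andP[/eqP e' tu]].
- by rewrite (ltn_trans tu st).
- by rewrite e' st.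
- by rewrite -e tu.
- by rewrite e' e eqxx (lexlt_trans st tu) orbT.
Qed.

Lemma better_total s t : size s = size t -> s != t -> better s t || better t s.
Proof. by rewrite /better; case: ltngtP => //= _; apply: lexlt_total. Qed.

Lemma better_addseq s t u : size s = size u -> size t = size u ->
  better s t -> better (addseq s u) (addseq t u).
Proof.
move=> su tu; rewrite /better !sumn_addseq // ltn_add2r eqn_add2r.
by case/orP => [->//|/andP[->] /lexlt_addseq ->]; rewrite ?orbT.
Qed.

Lemma exists_best (l : seq (seq nat)) : l != [::] ->
  exists2 s, s \in l & {in l, forall t, ~~ better t s}.
Proof.
elim: l => [//|s [|s' l] IH] _.
  by exists s; rewrite ?inE // => t; rewrite inE => /eqP ->; rewrite better_irr.
have [//|t tl tmin] := IH.
case: (boolP (better s t)) => st.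
  exists s; rewrite ?mem_head // => u; rewrite inE => /orP[/eqP ->|ul].
    by rewrite better_irr.
  by apply: contra (tmin u ul) => us; apply: better_trans us st.
exists t; first by rewrite inE tl orbT.
by move=> u; rewrite inE => /orP[/eqP ->|/tmin].
Qed.

Section NotInPower.
Variables (V : zmodType) (g : seq V).
Local Notation N := (size g).

Definition combination (s : seq nat) : V := \sum_(i < N) g`_i *+ nth 0%N s i.

(** Only sums of at least n terms are requested, not of exactly n: an element of
    the n-th power of the maximal ideal may absorb further factors. *)
Definition long_sum (n : nat) (c : V) :=
  exists s, [/\ size s = N, combination s = c & (n <= sumn s)%N].

Lemma combinationD s t : size s = size t ->
  combination (addseq s t) = combination s + combination t.
Proof.
move=> st; rewrite -big_split; apply: eq_bigr => i _ /=.
by rewrite nth_addseq // mulrnDr.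
Qed.

Definition standard (s : seq nat) : bool := `[< forall t,
  size t = size s -> combination t = combination s -> ~~ better t s >].

(** If a part s of t + s could be replaced by something better with the same
    sum, then so could the whole. *)
Lemma standard_downset : downset standard.
Proof.
move=> s t /all2_leq_addseq[u [su ->]] /asboolP tP.
apply/asboolP => s' ss cs; have su' : size s' = size u by rewrite ss.
apply: contra (tP (addseq s' u) _ _); first exact: better_addseq.
  by rewrite !size_addseq.
by rewrite !combinationD // cs.
Qed.

(** Not being a long sum bounds the lengths of all writings of c, so that only
    finitely many compete and a best one exists. *)
Lemma exists_standard n c : (exists2 s, size s = N & combination s = c) ->
  ~ long_sum n c ->
  exists s, [/\ standard s, size s = N, combination s = c & (sumn s < n)%N].
Proof.
move=> [s0 s0N s0c] nc.
have lt_n s : size s = N -> combination s = c -> (sumn s < n)%N.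
  by move=> sN sc; rewrite ltnNge; apply/negP => ns; apply: nc; exists s.
pose l := [seq s <- flatten [seq compositions N m | m <- iota 0 n]
          | combination s == c].
have memlP s : size s = N -> combination s = c -> s \in l.
  move=> sN sc; rewrite mem_filter sc eqxx; apply/flatten_mapP.
  by exists (sumn s); rewrite ?mem_iota ?lt_n // mem_compositions sN !eqxx.
have memlP' s : s \in l -> size s = N /\ combination s = c.
  rewrite mem_filter => /andP[/eqP sc /flatten_mapP[m _]].
  by rewrite mem_compositions => /andP[/eqP].
have [|s sl smin] := @exists_best l.
  by have := memlP _ s0N s0c; case: (l).
have [sN sc] := memlP' _ sl.
exists s; split; rewrite ?lt_n //; apply/asboolP => t ts tc.
by apply: smin; apply: memlP; rewrite ?ts ?tc.
Qed.

(** One entry per element that is not a long sum, namely the value of its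
    unique standard writing. *)
Definition short_sums (n : nat) : seq V :=
  [seq combination s | s <-
    [seq s <- flatten [seq compositions N m | m <- iota 0 n] | standard s]].

Lemma mem_short_sums n c : c \in short_sums n <->
  (exists2 s, size s = N & combination s = c) /\ ~ long_sum n c.
Proof.
split=> [/mapP[s]|[cN /(exists_standard cN)[s [sS sN sc sn]]]]; last first.
  apply/mapP; exists s => //; rewrite mem_filter sS; apply/flatten_mapP.
  by exists (sumn s); rewrite ?mem_iota ?sn // mem_compositions sN !eqxx.
rewrite mem_filter => /andP[/asboolP sS /flatten_mapP[m]].
rewrite mem_iota add0n => /andP[_ mn].
rewrite mem_compositions => /andP[/eqP sN /eqP sm] ->; split; first by exists s.
move=> [t [tN tc nt]]; have := sS t; rewrite tN sN => /(_ erefl tc)/negP; apply.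
by rewrite /better sm (leq_trans mn nt).
Qed.

Lemma short_sums_uniq n : uniq (short_sums n).
Proof.
rewrite map_inj_in_uniq => [|s t].
  apply: filter_uniq; elim: n => // n IH; rewrite -addn1 iotaD map_cat flatten_cat.
  rewrite cat_uniq IH /= cats0 compositions_uniq andbT add0n.
  apply/hasPn => s; rewrite mem_compositions => /andP[_ /eqP sn].
  apply/negP => /flatten_mapP[m]; rewrite mem_iota mem_compositions sn.
  by move=> /andP[_ mn] /andP[_ /eqP mE]; move: mn; rewrite mE ltnn.
rewrite !mem_filter => /andP[/asboolP sS /flatten_mapP[m _ sm]].
move=> /andP[/asboolP tS /flatten_mapP[m' _ tm]] st.
move: sm tm; rewrite !mem_compositions => /andP[/eqP sN _] /andP[/eqP tN _].
have sts : size s = size t by rewrite sN.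
apply/eqP; apply: contraT => /(better_total sts).
by rewrite (negPf (sS t _ _)) // (negPf (tS s _ _)).
Qed.

(** The standard writings of length m are counted by
    [eventually_poly_downset]; summing over m < n preserves polynomiality. *)
Lemma eventually_poly_short_sums : eventually_poly (fun n => size (short_sums n)).
Proof.
apply: eventually_poly_eq (eventually_poly_sum (eventually_poly_downset N
  standard_downset)).
exists 0 => n _; rewrite size_map size_filter count_flatten sumnE !big_map.
by rewrite /index_iota subn0.
Qed.

End NotInPower.

(** * Circulations and their generators *)

Section Circulations.
Variable G : graph.
Local Notation E := (oedge G).

Definition indicator (X : {set E}) : {ffun E -> int} := [ffun e => (e \in X)%:R].

(** Not only simple directed cycles but all nonempty sets of edges with equally
    many edges entering and leaving each vertex. This keeps the generators a
    finite set of 0/1 vectors and spares the choice of cycles. *)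
Definition circuit (X : {set E}) : bool :=
  (X != finset.set0) && (boundary (indicator X) == 0).

(** Whatever flows into a vertex flows out again, so each edge carrying flow is
    followed by another one; let f choose it. A nonempty set of edges of least
    size that carries flow and is stable under f is mapped bijectively to
    itself by f, hence is left by as many edges at each vertex as enter it. *)
Lemma exists_circuit (T : realDomainType) (x : E -> T) :
  (forall e, 0 <= x e) ->
  (forall v, \sum_e x e * ((tgt e == v)%:R - (src e == v)%:R) = 0) ->
  (exists e, x e != 0) ->
  exists2 X, circuit X & {in X, forall e, 0 < x e}.
Proof.
move=> x0 xv [e0 xe0].
have next e : exists e', 0 < x e -> 0 < x e' /\ src e' = tgt e.
  have [xe|] := boolP (0 < x e); last by exists e.
  have [|/forallNP nf] := pselect (exists e', 0 < x e' /\ src e' = tgt e).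
    by move=> [e' ?]; exists e'.
  exfalso; have := xv (tgt e); rewrite (bigD1 e) //= eqxx => /eqP.
  suff F e' : 0 <= x e' * ((tgt e' == tgt e)%:R - (src e' == tgt e)%:R).
    rewrite paddr_eq0 ?sumr_ge0 // => [/andP[+ _]|]; last by have := F e;
      rewrite eqxx.
    case: (src e =P tgt e) => [se|_]; first by have := nf e; rewrite xe se; case.
    by rewrite subr0 mulr1 gt_eqF.
  case: (eqVneq (src e') (tgt e)) => [se|_]; last by rewrite subr0 mulr_ge0.
  have := nf e'; rewrite lt_def x0 se andbT.
  by case: (eqVneq (x e') 0) => [->|_] h; [rewrite mul0r|case: h].
have [f fP] := choice next.
pose S := [set e | 0 < x e]%SET.
pose P X := [&& X != finset.set0, X \subset S & f @: X \subset X].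
have PS : P S.
  apply/and3P; split=> //; last first.
    by apply/fintype.subsetP => _ /imsetP[e eS ->]; rewrite inE in eS;
      rewrite inE; case: (fP e eS).
  by apply/set0Pn; exists e0; rewrite inE lt_def xe0 x0.
case: (@arg_minnP _ S P (fun X => #|X|) PS) => X /and3P[X0 XS fX] Xmin.
exists X; last by move=> e /(fintype.subsetP XS); rewrite inE.
have Pf : P (f @: X).
  apply/and3P; split; [|exact: fintype.subset_trans fX XS|exact: imsetS].
  by have /set0Pn[e eX] := X0; apply/set0Pn; exists (f e); apply: imset_f.
have fXE : f @: X = X by apply/eqP; rewrite eqEcard fX Xmin.
have finj : {in X &, injective f} by apply/imset_injP; rewrite fXE.
rewrite /circuit X0; apply/eqP/ffunP => v; rewrite !ffunE.
transitivity (\sum_(e in X) ((tgt e == v)%:R - (src e == v)%:R) : int).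
  rewrite [RHS]big_mkcond; apply: eq_bigr => e _; rewrite ffunE.
  by case: ifP; rewrite ?mul1r ?mul0r.
rewrite sumrB -{2}fXE big_imset //= -sumrB big1 // => e eX.
have := fintype.subsetP XS e eX; rewrite inE => /fP[_ ->]; exact: subrr.
Qed.

Definition generators : seq {ffun E ->
  int} := [seq indicator X | X <- enum circuit].
Local Notation g := generators.
Local Notation N := (size g).

Lemma generatorP (i : 'I_N) : exists2 X, circuit X & g`_i = indicator X.
Proof.
have /mapP[X XC ->] : g`_i \in g by rewrite mem_nth.
by exists X => //; rewrite mem_enum in XC.
Qed.

Lemma boundary_generator (i : 'I_N) : boundary g`_i = 0.
Proof. by have [X /andP[_ /eqP X0] ->] := generatorP i. Qed.

Lemma generator_ge0 (i : 'I_N) e : 0 <= g`_i e.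
Proof. by have [X _ ->] := generatorP i; rewrite ffunE ler0n. Qed.

Lemma generator_le1 (i : 'I_N) e : g`_i e <= 1.
Proof. by have [X _ ->] := generatorP i; rewrite ffunE; case: (_ \in _). Qed.

Lemma generator_neq0 (i : 'I_N) : exists e, g`_i e = 1.
Proof.
have [X /andP[/set0Pn[e eX] _] ->] := generatorP i.
by exists e; rewrite ffunE eX.
Qed.

Lemma mem_generator X : circuit X -> exists i : 'I_N, g`_i = indicator X.
Proof.
move=> XC; have iX : indicator X \in g by apply: map_f; rewrite mem_enum.
by exists (Ordinal (etrans (index_mem _ _) iX)); rewrite /= nth_index.
Qed.

Lemma boundaryB (z w : {ffun E ->
  int}) : boundary (z - w) = boundary z - boundary w.
Proof.
apply/ffunP => v; rewrite !ffunE -sumrB; apply: eq_bigr => e _ /=.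
by rewrite !ffunE mulrBl.
Qed.

Lemma boundaryMn (z : {ffun E -> int}) n : boundary (z *+ n) = boundary z *+ n.
Proof.
elim: n => [|n IH]; last by rewrite !mulrS boundaryD IH.
by apply/ffunP => v; rewrite !ffunE big1 // => e _; rewrite ffunE mul0r.
Qed.

Lemma boundary_sum (I : Type) (r : seq I) (F : I -> {ffun E -> int}) :
  boundary (\sum_(i <- r) F i) = \sum_(i <- r) boundary (F i).
Proof.
elim/big_rec2: _ => [|i y x _ <-]; last by rewrite boundaryD.
by have := boundaryMn 0 0; rewrite !mulr0n.
Qed.

Lemma combination_boundary s : boundary (combination g s) = 0.
Proof.
by rewrite boundary_sum big1 // => i _;
  rewrite boundaryMn boundary_generator mul0rn.
Qed.

Lemma combinationE s e : combination g s e = \sum_(i < N) g`_i e *+ nth 0%N s i.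
Proof. by rewrite sum_ffunE; apply: eq_bigr => i _; rewrite ffunMnE. Qed.

Lemma combination_ge0 s e : 0 <= combination g s e.
Proof.
by rewrite combinationE sumr_ge0 // => i _; rewrite mulrn_wge0 // generator_ge0.
Qed.

Lemma combination_unit (i : 'I_N) :
  combination g (mkseq (fun j => (i == j :> nat) : nat) N) = g`_i.
Proof.
rewrite /combination (bigD1 i) //= nth_mkseq // eqxx mulr1n big1 ?addr0 // => j ji.
by rewrite nth_mkseq // eq_sym (inj_eq val_inj) (negPf ji).
Qed.

Lemma sumn_unit (i : 'I_N) : sumn (mkseq (fun j => (i == j :> nat) : nat) N) = 1%N.
Proof.
rewrite sumnE big_map -/(index_iota 0 N) (_ : iota 0 N = index_iota 0 N);
  last first.
  by rewrite /index_iota subn0.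
rewrite big_mkord (bigD1 i) //= eqxx big1 // => j ji.
by rewrite eq_sym (inj_eq val_inj) (negPf ji).
Qed.

Lemma combination0 : combination g (nseq N 0%N) = 0.
Proof. by rewrite /combination big1 // => i _; rewrite nth_nseq if_same mulr0n. Qed.

(** In an integral circulation each edge of a circuit in the support carries at
    least 1, so the circuit can be subtracted. *)
Lemma circulation_combination (z : {ffun E -> int}) :
  boundary z = 0 -> (forall e, 0 <= z e) ->
  exists2 s, size s = N & combination g s = z.
Proof.
have [n] := ubnP (\sum_e `|z e|%N)%N; elim: n z => // n IH z;
  rewrite ltnS => zn bz z0.
have [->|zn0] := eqVneq z 0.
  by exists (nseq N 0%N); rewrite ?size_nseq ?combination0.
have [||X XC Xz] := @exists_circuit int z z0.
- by move=> v; have := congr1 (fun h : {ffun _ -> int} => h v) bz; rewrite !ffunE.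
- apply/existsP; apply: contraR zn0 => /existsPn nz.
  by apply/eqP/ffunP => e; rewrite ffunE; apply/eqP; have := nz e; rewrite negbK.
have [i gi] := mem_generator XC.
have z'0 e : 0 <= (z - indicator X) e.
  rewrite !ffunE; have [/Xz|_] := boolP (e \in X); last by rewrite subr0.
  by rewrite subr_ge0 gtz0_ge1.
have [|||s sN sz] := IH (z - indicator X).
- apply: leq_trans zn; have /andP[/set0Pn[e0 e0X] _] := XC.
  rewrite [X in (X < _)%N](bigD1 e0) // [X in (_ < X)%N](bigD1 e0) //=.
  rewrite -addSn; apply: leq_add; last apply: leq_sum => e _;
    rewrite !ffunE ?e0X; last by case: (boolP (e \in X)) => [/Xz|_] /=;
      rewrite ?subr0 //; lia.
  by have := Xz _ e0X; move: (z e0) => y /=; lia.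
- by rewrite boundaryB bz; case/andP: XC => _ /eqP ->; rewrite subr0.
- exact: z'0.
exists (addseq s (mkseq (fun j => (i == j :> nat) : nat) N)).
  by rewrite size_addseq size_mkseq.
by rewrite combinationD ?size_mkseq // combination_unit sz gi subrK.
Qed.

Definition ones : {ffun E -> int} := [ffun=> 1].

(** The reversal of edges exchanges sources and targets. *)
Lemma boundary_ones : boundary ones = 0.
Proof.
apply/ffunP => v; rewrite !ffunE.
under eq_bigr do rewrite ffunE mul1r.
rewrite sumrB [X in X - _](reindex_inj (inv_inj (@einvK G))) /=.
by under [X in X - _]eq_bigr do rewrite -src_tgt; rewrite subrr.
Qed.

End Circulations.

(** * The cone and the weight of its decompositions *)

Section RealCone.
Variables (R : realType) (G : graph).
Local Notation E := (oedge G).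
Local Notation g := (generators G).
Local Notation N := (size g).
Local Notation sigma := (cographic_cone R G).
Local Notation H := (homology G).
Local Notation real := (@realify R (oedge G)).

Lemma flow_boundary (z : {ffun E -> int}) v :
  \sum_e real z e * ((tgt e == v)%:R - (src e == v)%:R) = (boundary z v)%:~R.
Proof.
rewrite ffunE raddf_sum; apply: eq_bigr => e _ /=.
by rewrite intrM intrB !rmorph_nat.
Qed.

Lemma sigma_flow x v : sigma x ->
  \sum_e x e * ((tgt e == v)%:R - (src e == v)%:R) = 0.
Proof.
move=> [[n [a [w [wH ->]]]] _]; rewrite /lincomb.
under eq_bigr do rewrite mulr_suml.
rewrite exchange_big big1 // => j _; have [z zH <-] := wH j.
under eq_bigr do rewrite -mulrA.
by rewrite -mulr_sumr flow_boundary zH ffunE mulr0.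
Qed.

(** [heavy t x] says that the concave function phi of the introduction is at
    least t at x. Working with this relation avoids the supremum. *)
Definition heavy (t : R) (x : E -> R) := exists a : 'I_N -> R,
  [/\ forall i, 0 <= a i, x = lincomb a (fun i => real g`_i) & t <= \sum_i a i].

Lemma heavy_le t u x : u <= t -> heavy t x -> heavy u x.
Proof. by move=> ut [a [a0 xa ta]]; exists a; split=> //; apply: le_trans ta. Qed.

Lemma heavyD t u x y : heavy t x -> heavy u y -> heavy (t + u) (fun e => x e + y e).
Proof.
move=> [a [a0 -> ta]] [b [b0 -> ub]]; exists (fun i => a i + b i); split.
- by move=> i; rewrite addr_ge0.
- apply/funext => e; rewrite /lincomb -big_split; apply: eq_bigr => i _ /=.
  by rewrite mulrDl.
- by rewrite big_split lerD.
Qed.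

Lemma heavyZ t c x : 0 <= c -> heavy t x -> heavy (c * t) (fun e => c * x e).
Proof.
move=> c0 [a [a0 -> ta]]; exists (fun i => c * a i); split.
- by move=> i; rewrite mulr_ge0.
- by apply/funext => e; rewrite /lincomb mulr_sumr; apply: eq_bigr => i _;
  rewrite mulrA.
- by rewrite -mulr_sumr ler_wpM2l.
Qed.

Lemma heavy0 : heavy 0 (fun=> 0).
Proof.
exists (fun=> 0); split=> //; last by rewrite big1.
by apply/funext => e; rewrite /lincomb big1 // => i _; rewrite mul0r.
Qed.

Lemma heavy_generator (i : 'I_N) : heavy 1 (real g`_i).
Proof.
exists (fun j => (j == i)%:R); split=> //; last first.
  by rewrite (bigD1 i) //= eqxx lerDl sumr_ge0.
apply/funext => e; rewrite /lincomb (bigD1 i) //= eqxx mul1r big1 ?addr0 // => j ji.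
by rewrite (negPf ji) mul0r.
Qed.

Lemma heavy_sigma t x : heavy t x -> sigma x.
Proof.
move=> [a [a0 -> _]]; split.
  exists N, a, (fun i => real g`_i); split=> // i.
  by exists g`_i => //; apply: boundary_generator.
by move=> e; rewrite sumr_ge0 // => i _; rewrite mulr_ge0 // ler0z generator_ge0.
Qed.

(** Subtract from x the largest multiple of a circuit in its support that leaves
    a nonnegative vector; this empties at least one edge. *)
Lemma sigma_heavy x : sigma x -> heavy 0 x.
Proof.
have [n] := ubnP #|[set e | x e != 0]%SET|; elim: n x => // n IH x;
  rewrite ltnS => xn sx.
have x0 := sx.2.
have [/forallP xz|] := boolP [forall e, x e == 0].
  by rewrite (_ : x = fun=> 0); [exact: heavy0|apply/funext => e; apply/eqP].
rewrite negb_forall => /existsP ex.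
have [X XC Xx] := exists_circuit x0 (fun v => sigma_flow v sx) ex.
have [i gi] := mem_generator XC.
have [/set0Pn[e0 e0X] _] := andP XC.
case: (@arg_minP _ _ _ e0 (mem X) x e0X) => e1 e1X e1min.
pose m := x e1; have m0 : 0 < m by apply: Xx.
pose x' e := x e - m * real g`_i e.
have gE e : real g`_i e = (e \in X)%:R by rewrite /realify gi ffunE rmorph_nat.
have sx' : sigma x'.
  split; last first.
    move=> e; rewrite /x' gE; have [eX|_] := boolP (e \in X).
      by rewrite mulr1 subr_ge0 e1min.
    by rewrite mulr0 subr0.
  case: sx => [[p [a [w [wH xE]]]] _].
  exists p.+1, (fun j => if unlift ord0 j is Some j' then a j' else - m),
         (fun j => if unlift ord0 j is Some j' then w j' else real g`_i); split.
    move=> j; case: unliftP => [j' _|_] //; exists g`_i => //;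
      exact: boundary_generator.
  apply/funext => e; rewrite /x' [in LHS]xE /lincomb big_ord_recl unlift_none
    mulNr [RHS]addrC.
  by congr (_ - _); apply: eq_bigr => j _; rewrite liftK.
have hx' : heavy 0 x'.
  apply: IH => //; apply: leq_trans xn; apply: proper_card; apply/properP; split.
    apply/fintype.subsetP => e; rewrite !inE; apply: contraNneq => xe.
    by rewrite /x' gE xe; have [/Xx|_] := boolP (e \in X);
       [rewrite xe ltxx|rewrite mulr0 subr0].
  exists e1; rewrite inE; first by rewrite gt_eqF.
  by rewrite /x' gE (_ : e1 \in X) // mulr1 subrr eqxx.
have := heavyD hx' (heavyZ (ltW m0) (heavy_generator i)).
rewrite (_ : (fun e => _) = x); last by apply/funext => e; rewrite /x' subrK.
by apply: heavy_le; rewrite add0r mulr1 ltW.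
Qed.

(** Each generator has total at least 1. *)
Lemma heavy_sum_ge t x : heavy t x -> t <= \sum_e x e.
Proof.
move=> [a [a0 -> ta]]; apply: le_trans ta _; rewrite exchange_big /=.
apply: ler_sum => i _; rewrite -mulr_sumr ler_peMr //.
have [e ge] := generator_neq0 i.
rewrite (bigD1 e) //= /realify ge lerDl sumr_ge0 // => f _.
by rewrite ler0z generator_ge0.
Qed.

(** The generators have coefficients at most 1. This bounds the complement of
    K_+ in sigma. *)
Lemma light_le1 x e : sigma x -> ~ heavy 1 x -> x e <= 1.
Proof.
move=> /sigma_heavy[a [a0 xa _]] nh.
have s1 : \sum_i a i <= 1.
  by rewrite leNgt; apply/negP => s1; apply: nh; exists a; rewrite ltW.
apply: le_trans s1; rewrite xa; apply: ler_sum => i _.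
by rewrite ler_piMr // -[1]/(1%:~R) ler_int generator_le1.
Qed.

Lemma combination_heavy s : size s = N ->
  heavy (sumn s)%:R (real (combination g s)).
Proof.
move=> sN; exists (fun i : 'I_N => (nth 0%N s i)%:R); split=> //.
  apply/funext => e; rewrite /realify combinationE raddf_sum;
    apply: eq_bigr => i _ /=.
  by rewrite rmorphMn /= mulr_natl.
by rewrite -natr_sum sumnE (big_nth 0%N) big_mkord sN.
Qed.

Lemma long_sum_heavy n z : long_sum g n z -> heavy n%:R (real z).
Proof.
move=> [s [sN <- ns]]; apply: heavy_le (combination_heavy sN).
by rewrite ler_nat.
Qed.

(** Round the N weights down. The loss is less than N, and what remains of z is
    a nonnegative integral circulation, hence a combination of generators that
    can be added back. *)
Lemma heavy_long_sum n (z : {ffun E -> int}) : heavy (n + N)%:R (real z) ->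
  long_sum g n z.
Proof.
move=> [a [a0 za na]].
pose s := mkseq (fun i => if insub i is Some i' then Num.truncn (a i') else 0%N) N.
have sN : size s = N by rewrite size_mkseq.
have sE (i : 'I_N) : nth 0%N s i = Num.truncn (a i).
  by rewrite nth_mkseq // insubT // => iN; congr (Num.truncn (a _)); apply/val_inj.
have bz : boundary z = 0.
  apply/ffunP => v; apply/eqP; rewrite -(eqr_int R) -flow_boundary [in X in _ ==
    X]ffunE.
  by rewrite sigma_flow ?eqxx //; apply: (@heavy_sigma (n + N)%:R); exists a.
have [|e|t tN tz] := @circulation_combination G (z - combination g s).
- by rewrite boundaryB bz combination_boundary subrr.
- rewrite !ffunE subr_ge0 -(ler_int R) -[(z e)%:~R]/(real z e) za combinationE.
  rewrite raddf_sum; apply: ler_sum => i _ /=.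
  rewrite rmorphMn /= -mulr_natl ler_wpM2r ?ler0z ?generator_ge0 // sE.
  by have /truncn_itv/andP[] := a0 i.
have st : size s = size t by rewrite sN tN.
exists (addseq s t); split; first by rewrite size_addseq.
  by rewrite combinationD // tz addrC subrK.
rewrite sumn_addseq // (leq_trans _ (leq_addr _ _)) //.
rewrite -(leq_add2r N) -(ler_nat R) (le_trans na) //.
rewrite sumnE (big_nth 0%N) big_mkord sN -[X in (_ + X)%N]card_ord -sum1_card
  -big_split.
rewrite natr_sum; apply: ler_sum => i _ /=; rewrite sE addn1.
by have /truncn_itv/andP[_ /ltW] := a0 i.
Qed.

Lemma heavy_lincomb n (a t : 'I_n -> R) v : (forall j, 0 <= a j) ->
  (forall j, heavy (t j) (v j)) -> heavy (\sum_j a j * t j) (lincomb a v).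
Proof.
elim: n a t v => [|n IH] a t v a0 hv.
  rewrite big_ord0 (_ : lincomb a v = fun=> 0); first exact: heavy0.
  by apply/funext => e; rewrite /lincomb big_ord0.
rewrite big_ord_recl.
have := heavyD (heavyZ (a0 ord0) (hv ord0)) (IH _ _ _ (fun j =>
  a0 (lift ord0 j)) (fun j => hv (lift ord0 j))).
by congr heavy; apply/funext => e; rewrite /lincomb big_ord_recl.
Qed.

Lemma lattice_point_heavy z : lattice_points H sigma z -> z != 0 ->
  heavy 1 (real z).
Proof.
move=> /cographic_pointsP[bz z0] zn0.
have [s sN sz] := circulation_combination bz z0.
rewrite -sz; apply: heavy_le (combination_heavy sN); rewrite ler1n lt0n.
apply: contraNneq zn0 => s0; rewrite -sz /combination big1 // => i _.
have : all (pred1 0%N) s.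
  by elim: s s0 {sN sz} => //= d s IH /eqP; rewrite addn_eq0 => /andP[-> /eqP/IH].
by move=> /(all_nthP 0%N)/(_ i); rewrite sN => /(_ (ltn_ord i))/eqP ->;
  rewrite mulr0n.
Qed.

Lemma Kplus_heavy x : Kplus H sigma x -> heavy 1 x.
Proof.
move=> [n [a [v [vz a0 a1 ->]]]].
rewrite -a1; under eq_bigr do rewrite -[a _]mulr1.
apply: heavy_lincomb => // j; have [z [zL /eqP z0] <-] := vz j.
exact: lattice_point_heavy.
Qed.

(** If the weights a_i have sum s >= 1, then x is a convex combination of the
    points s g_i, which need not be integral; but each of them lies on the
    segment from g_i to m g_i for an integer m > s. *)
Lemma heavy_Kplus x : heavy 1 x -> Kplus H sigma x.
Proof.
move=> [a [a0 -> s1]]; set s := \sum_i a i in s1.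
have s0 : 0 < s by apply: lt_le_trans s1.
(* With weight th on m g_i and 1 - th on g_i the mean length is s. *)
pose m := (Num.truncn s).+1.
have sm : s < m%:R by have /truncn_itv/andP[] := ltW s0.
have m1 : 1 < m%:R :> R by apply: le_lt_trans sm.
pose th := (s - 1) / (m%:R - 1).
have mpos : 0 < m%:R - 1 :> R by rewrite subr_gt0.
have th0 : 0 <= th by rewrite divr_ge0 ?subr_ge0 // ltW.
have th1 : th <= 1 by rewrite ler_pdivrMr // mul1r lerD2r ltW.
exists (N + N)%N.
exists (fun j : 'I_(N + N) => match fintype.split j with inl i =>
  (1 - th) * (a i / s)
                                  | inr i => th * (a i / s) end).
exists (fun j : 'I_(N + N) => match fintype.split j with inl i =>
  real g`_i | inr i => real (g`_i *+ m) end).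
have gL (i : 'I_N) p : (0 < p)%N ->
    (real @` (lattice_points H sigma `\ 0))%classic (real (g`_i *+ p)).
  move=> p0; exists (g`_i *+ p) => //; split.
    apply/cographic_pointsP; rewrite boundaryMn boundary_generator mul0rn;
      split=> // e.
    by rewrite ffunMnE mulrn_wge0 // generator_ge0.
  have [e ge] := generator_neq0 i => /(congr1 (fun f : {ffun E -> int} => f e)).
  by rewrite ffunMnE ge ffunE => /eqP; rewrite pnatr_eq0 gtn_eqF.
split.
- by move=> j; case: (fintype.split j) => i; [rewrite -[g`_i]mulr1n|]; exact: gL.
- move=> j; have as0 i : 0 <= a i / s by rewrite divr_ge0 // ltW.
  by case: (fintype.split j) => i; rewrite mulr_ge0 ?subr_ge0.
- rewrite big_split_ord /=.
  under eq_bigr => i _ do rewrite (unsplitK (inl i)).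
  under [X in _ + X]eq_bigr => i _ do rewrite (unsplitK (inr i)).
  by rewrite -!mulr_sumr -mulr_suml -/s divff ?gt_eqF // !mulr1 subrK.
- apply/funext => e; rewrite /lincomb big_split_ord /=.
  under [X in _ = X + _]eq_bigr => i _ do rewrite (unsplitK (inl i)).
  under [X in _ = _ + X]eq_bigr => i _ do rewrite (unsplitK (inr i)).
  rewrite -big_split; apply: eq_bigr => i _ /=.
  rewrite /realify ffunMnE rmorphMn /= -mulr_natl.
  rewrite [X in _ = _ + X]mulrA -mulrDl; congr (_ * _).
  by rewrite /th; field; rewrite gt_eqF //= gt_eqF.
Qed.

End RealCone.

(** * Bases of the homology lattice *)

Lemma ffunMzE (I : finType) (f : {ffun I ->
  int}) (c : int) x : (f *~ c) x = f x * c.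
Proof.
by rewrite -mulrzz; case: c => n; rewrite /intmul ?ffunE ffunMnE.
Qed.

(** Adding a multiple of the circulation with all coefficients 1 makes any
    circulation nonnegative, so sigma spans the whole homology. *)
Lemma span_lattice_homology (R : realType) (G : graph) :
  span_lattice (homology G) (cographic_cone R G) = homology G.
Proof.
apply/seteqP; split=> [z []//|z Hz]; split=> //.
pose m := (\sum_e `|z e|%N)%N.
pose v (j : 'I_2) := if j == ord0 then z + ones G *+ m else ones G.
have zv e : 0 <= z e + m%:R.
  have : (`|z e|%N <= m)%N by rewrite /m (bigD1 e) //= leq_addr.
  by move: (z e) => y; lia.
exists 2%N, (fun j => if j == ord0 then 1 else - m%:R), (fun j => realify R (v j)).
split=> [j|].
  suff [] : lattice_points (homology G) (cographic_cone R G) (v j) by [].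
  apply/cographic_pointsP; rewrite /v; case: eqP => _; split=> [|e].
  - by rewrite boundaryD Hz boundaryMn boundary_ones mul0rn addr0.
  - by rewrite ffunE ffunMnE ffunE.
  - exact: boundary_ones.
  - by rewrite ffunE.
apply/funext => e; rewrite /lincomb big_ord_recl big_ord1 /= /v /=.
have e1 : (z + ones G *+ m) e = z e + m%:R by rewrite ffunE ffunMnE ffunE.
have e2 : ones G e = 1 by rewrite ffunE.
by rewrite /realify e1 e2 intrD rmorph_nat; ring.
Qed.

(** Bring the boundary matrix to Smith normal form. In the coordinates given by
    the left unimodular factor, the kernel consists of the vectors supported on
    the zero rows of the diagonal matrix. *)
Lemma homology_Zbasis (G : graph) : exists b, is_Zbasis (homology G) b.
Proof.
pose m := #|oedge G|; pose n := #|vertex G|.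
pose D : 'M[int]_(m, n) := \matrix_(i, j)
  ((tgt (enum_val i) == enum_val j)%:R - (src (enum_val i) == enum_val j)%:R).
pose row_of (z : {ffun oedge G -> int}) : 'rV[int]_m := \row_i z (enum_val i).
pose ffun_of (u : 'rV[int]_m) : {ffun oedge G ->
  int} := [ffun e => u 0 (enum_rank e)].
have row_ofK : cancel row_of ffun_of.
  by move=> z; apply/ffunP => e; rewrite ffunE mxE enum_rankK.
have ffun_ofK : cancel ffun_of row_of.
  by move=> u; apply/rowP => i; rewrite mxE ffunE enum_valK.
have HD z : homology G z <-> row_of z *m D = 0.
  have zD j : (row_of z *m D) 0 j = boundary z (enum_val j).
    rewrite !mxE ffunE [RHS](reindex_onto enum_val enum_rank) => [|e _];
      last exact: enum_rankK.
    by apply: eq_big => i; rewrite ?enum_valK ?eqxx // => _; rewrite !mxE.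
  split=> [zH|zH0]; first by apply/rowP => j; rewrite zD zH ffunE mxE.
  by apply/ffunP => v; rewrite -[v]enum_rankK -zD zH0 mxE ffunE.
have [L Lu [Rm Ru [d _ DE]]] := int_Smith_normal_form D.
set Dg := \matrix_(i, j) _ in DE.
have DgE (u : 'rV[int]_m) : u *m Dg = 0 <-> forall i, row i Dg != 0 -> u 0 i = 0.
  split=> [uD i|ui].
    case/rV0Pn => j; rewrite !mxE; case: (nat_of_ord i =P j) => [ij|];
      last by rewrite mulr0n eqxx.
    rewrite mulr1n => di; have := congr1 (fun X : 'rV[int]_n => X 0 j) uD.
    rewrite !mxE (bigD1 i) //= big1 => [|i' ii'].
      by rewrite mxE ij eqxx addr0 mulr1n => /eqP;
        rewrite mulf_eq0 -ij (negPf di) orbF => /eqP.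
    rewrite mxE; case: eqP => [i'j|_]; last by rewrite mulr0.
    by case/eqP: ii'; apply: val_inj; rewrite /= i'j.
  apply/rowP => j; rewrite !mxE big1 // => i _.
  have [/rowP/(_ j)|/ui ->] := eqVneq (row i Dg) 0; last by rewrite mul0r.
  by rewrite !mxE => ->; rewrite mulr0.
have HE z : homology G z <-> forall i, row i Dg != 0 -> (row_of z *m L) 0 i = 0.
  rewrite HD -DgE DE !mulmxA; split=> [/(congr1 (fun X => X *m invmx Rm))|->].
    by rewrite mulmxK // mul0mx.
  by rewrite mul0mx.
pose s := enum [pred i | row i Dg == 0].
pose F i := ffun_of (row i (invmx L)).
pose b := [seq F i | i <- s].
pose f (j : 'I_(size b)) : 'I_m := tnth (in_tuple s) (cast_ord (size_map F s) j).
have bE (j : 'I_(size b)) : b`_j = F (f j).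
  rewrite /f (tnth_nth (f j)) /= (nth_map (f j)) //.
  by rewrite -(size_map F).
have finj : injective f.
  move=> i j; rewrite /f !(tnth_nth (f i)) /= => /eqP.
  rewrite nth_uniq ?enum_uniq -?(size_map F) ?ltn_ord // => /eqP ?; exact/val_inj.
have fs j : row (f j) Dg == 0.
  by have := mem_tnth (cast_ord (size_map F s) j) (in_tuple s);
    rewrite mem_enum inE.
have fonto i : row i Dg == 0 -> exists j, f j = i.
  move=> i0; have i_s : i \in s by rewrite mem_enum inE.
  have ib : (index i s < size b)%N by rewrite size_map index_mem.
  by exists (Ordinal ib); rewrite /f (tnth_nth i) /= nth_index.
have combL (c : 'I_(size b) -> int) :
    row_of (\sum_(j < size b) b`_j *~ c j) *m L = \sum_j c j *: delta_mx 0 (f j).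
  have -> : row_of (\sum_(j < size b) b`_j *~ c j) = \sum_j c j *: row (f j)
    (invmx L).
    apply/rowP => i; rewrite mxE sum_ffunE summxE; apply: eq_bigr => j _.
    by rewrite bE mxE ffunMzE -[in RHS](ffun_ofK (row _ _)) mxE mulrC.
  rewrite mulmx_suml; apply: eq_bigr => j _.
  by rewrite -scalemxAl -row_mul mulVmx // rowE mulmx1.
have dE (c : 'I_(size b) -> int) j : (\sum_j c j *: delta_mx 0 (f j) :
  'rV[int]_m) 0 (f j) = c j.
  rewrite summxE (bigD1 j) //= !mxE !eqxx mulr1 big1 ?addr0 // => i ij.
  by rewrite !mxE eqxx (inj_eq finj) eq_sym (negPf ij) mulr0.
have row_of_inj : injective row_of := can_inj row_ofK.
have Linj : injective (fun z => row_of z *m L).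
  by move=> z w /(congr1 (fun X => X *m invmx L));
    rewrite !mulmxK // => /row_of_inj.
exists b; split=> [z /mapP[i]|z Hz].
  rewrite mem_enum inE => i0 ->; apply/HE => j jn0.
  rewrite ffun_ofK -row_mul mulVmx // !mxE; case: eqP => // ij.
  by rewrite -ij i0 in jn0.
exists (fun j => (row_of z *m L) 0 (f j)); split; last first.
  by move=> c' ->; apply/funext => j; rewrite combL dE.
apply: Linj; rewrite /= combL; apply/rowP => i.
have [i0|i0] := boolP (row i Dg == 0).
  by have [j <-] := fonto i i0; rewrite dE.
rewrite (HE z).1 // summxE big1 // => j _; rewrite !mxE eqxx /=.
by case: eqP => [ij|]; [rewrite ij fs in i0|rewrite mulr0].
Qed.

(** A rational relation between the vectors of b becomes, after clearing
    denominators, an integral one, which uniqueness of coordinates forbids.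
    So the rows of b are independent over the rationals and have a right
    inverse there. *)
Lemma Zbasis_right_inverse (R : realType) (I : finType) (L : set {ffun I ->
  int}) b :
  L 0 -> is_Zbasis L b ->
  exists Q : I -> 'I_(size b) -> R, forall i j : 'I_(size b),
    \sum_e realify R b`_i e * Q e j = (i == j)%:R.
Proof.
move=> L0 [_ bU].
pose M : 'M[rat]_(size b, #|I|) := \matrix_(i, e) (b`_i (enum_val e))%:~R.
suff /row_freeP[Q MQ] : row_free M.
  exists (fun e j => ratr (Q (enum_rank e) j)) => i j.
  have /(congr1 (@ratr R)) := congr1 (fun X : 'M[rat]_(size b) => X i j) MQ.
  rewrite !mxE rmorph_nat => <-; rewrite rmorph_sum.
  rewrite [LHS](reindex_onto enum_val enum_rank) => [|e _]; last exact: enum_rankK.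
  apply: eq_big => e; rewrite ?enum_valK ?eqxx // => _.
  by rewrite rmorphM /= mxE ratr_int.
rewrite -kermx_eq0; apply: contraT => /rowV0Pn[u /sub_kermxP uM] /eqP[].
pose c i : int := (\prod_(j | j != i) denq (u 0 j)) * numq (u 0 i).
pose m : int := \prod_j denq (u 0 j).
have cE i : (c i)%:~R = m%:~R * u 0 i :> rat.
  by rewrite /c /m [in RHS](bigD1 i) //= !intrM numqE; ring.
have [c0 [_ cU]] := bU 0 L0.
have c00 : c0 = fun=> 0 by apply: cU; rewrite big1 // => i _; rewrite mulr0z.
have cc0 : c0 = c.
  apply: cU; apply/esym/ffunP => e; rewrite sum_ffunE ffunE.
  apply/eqP; rewrite -(eqr_int rat) raddf_sum /=; apply/eqP.
  have := congr1 (fun X : 'rV[rat]_#|I| => m%:~R * X 0 (enum_rank e)) uM.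
  rewrite !mxE mulr0 mulr_sumr => ue; rewrite -[RHS]ue; apply: eq_bigr => i _.
  rewrite mxE enum_rankK mulrA -cE -intrM; congr (_%:~R).
  by rewrite ffunMzE mulrC.
apply/rowP => i; rewrite mxE; apply/eqP; rewrite -numq_eq0.
have := congr1 (fun h => h i) cc0; rewrite c00 /c => /esym/eqP.
rewrite mulf_eq0 => /orP[|//]; rewrite prodf_seq_eq0 => /hasP[j _].
by rewrite denq_eq0 andbF.
Qed.

(** * Lengths of the powers of the maximal ideal *)

Section Length.
Variables (k : fieldType) (M : conomType) (deg : M -> nat).
Hypothesis degM : forall c d, deg (mmul c d) = (deg c + deg d)%N.
Hypothesis deg_gt0 : forall c, c != mone -> (0 < deg c)%N.

Local Notation A := {malg k[M]}.
Variable p : prime_idealr A.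
Hypothesis pE : forall f : A, (f \in (p : pred A)) = (mcoeff mone f == 0).

Local Notation O := (localization p).
Local Notation frac := (@Localization.frac A p).
Local Notation denom1 := (Localization.denom1 p).

(** [factors n c] says that c is a product of n factors other than 1 and one
    arbitrary factor. *)
Fixpoint factors (n : nat) (c : M) : Prop :=
  if n is n'.+1 then exists g c', [/\ g != mone, factors n' c' & c = mmul g c']
  else True.

Lemma factorsMl n c d : factors n c -> factors n (mmul d c).
Proof.
elim: n c d => [//|n IH] c d [g [c' [g1 c'n ->]]].
exists g, (mmul d c'); split => //; first exact: IH.
by rewrite !mulmA (mulmC d).
Qed.

Definition supp_in (T : M -> Prop) (f : A) := forall c, mcoeff c f != 0 -> T c.

(** For T closed under multiplication by monomials this is the ideal of O
    generated by the monomials in T. *)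
Definition monom_ideal (T : M -> Prop) : set O :=
  [set x | exists a s, supp_in T a /\ x = frac a s]%classic.

Lemma supp_inD T f g : supp_in T f -> supp_in T g -> supp_in T (f + g).
Proof.
move=> fT gT c; rewrite mcoeffD.
case: (eqVneq (mcoeff c f) 0) => [->|/fT //]; by rewrite add0r => /gT.
Qed.

Lemma supp_inM T1 T2 T f g : (forall c d, T1 c -> T2 d -> T (mmul c d)) ->
  supp_in T1 f -> supp_in T2 g -> supp_in T (f * g).
Proof.
move=> T12 fT gT c; rewrite mcoeff_neq0 => /msuppM_le[c1 [c2 []]].
by rewrite -!mcoeff_neq0 => /fT ? /gT ? ->; apply: T12.
Qed.

Lemma monom_idealM T1 T2 T x y : (forall c d, T1 c -> T2 d -> T (mmul c d)) ->
  monom_ideal T1 x -> monom_ideal T2 y -> monom_ideal T (x * y).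
Proof.
move=> T12 [a [s [aT ->]]] [b [t [bT ->]]].
exists (a * b), (Localization.mulden s t); rewrite Localization.fracM; split=> //.
exact: supp_inM aT bT.
Qed.

Lemma monom_idealT x : monom_ideal (fun=> True) x.
Proof. by elim/Localization.fracW: x => a s; exists a, s; split. Qed.

Lemma monom_ideal_is_ideal T : (forall c d, T d -> T (mmul c d)) ->
  is_ideal (monom_ideal T).
Proof.
move=> TM; split.
- by exists 0, denom1; split=> // c; rewrite mcoeff0 eqxx.
- move=> _ _ [a [s [aT ->]]] [b [t [bT ->]]].
  rewrite Localization.fracD; eexists; eexists; split; last by [].
  by apply: supp_inD; [apply: supp_inM aT (_ : supp_in xpredT _)
                      |apply: supp_inM bT (_ : supp_in xpredT _)] => // c d Tc _;
    rewrite mulmC; apply: TM.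
- move=> x y yT; apply: monom_idealM (monom_idealT x) yT => c d _; exact: TM.
Qed.

(** By degree, X^c arises in v X^c only from the constant term of v. *)
Lemma mcoeff_unit_monom (v : A) c :
  mcoeff mone v != 0 -> mcoeff c (v * << c >>) != 0.
Proof.
move=> v0; set v1 := mcoeff mone v in v0.
rewrite -[v](subrK (v1%:MP)) mulrDl mcoeffD mcoeffCM mcoeffUU mulr1.
rewrite (_ : mcoeff c _ = 0) ?add0r //; apply/eqP; apply: contraT.
rewrite mcoeff_neq0 => /msuppM_le[d [e []]].
rewrite msuppU oner_eq0 => d0; rewrite finmap.in_fset1 => /eqP ->.
case: (eqVneq d mone) d0 => [->|/deg_gt0 d0 _ /(congr1 deg)];
  last by rewrite degM; lia.
by rewrite -mcoeff_neq0 mcoeffB mcoeffC eqxx mulr1n subrr eqxx.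
Qed.

(** Localizing does not create new monomials in the ideal, because a denominator
    has a nonzero constant term and so cannot cancel X^c. *)
Lemma monom_in_ideal (T : M -> Prop) c : (forall c d, T d -> T (mmul c d)) ->
  monom_ideal T (frac << c >> denom1) <-> T c.
Proof.
move=> TM; split=> [[a [s [aT /Localization.fracP[u up /= ue]]]]|Tc].
  have sp := valP s; rewrite -topredE /= in sp.
  have us : mcoeff mone (u * sval s) != 0.
    by rewrite -pE Localization.denomM.
  have := mcoeff_unit_monom c us; rewrite -mulrA [sval s * _]mulrC ue mulr1.
  by apply: supp_inM (_ : supp_in xpredT _) aT _ => // c1 c2 _; apply: TM.
exists << c >>, denom1; split=> // d.
by rewrite mcoeffU1; case: (c =P d) => [<-//|_]; rewrite eqxx.
Qed.

Lemma monom_idealS (T1 T2 : M -> Prop) : (forall c, T1 c -> T2 c) ->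
  (monom_ideal T1 `<=` monom_ideal T2)%classic.
Proof.
move=> T12 _ [a [s [aT ->]]]; exists a, s; split=> // c /aT; exact: T12.
Qed.

Lemma nonunit_monom (x : O) : nonunits x -> monom_ideal (factors 1) x.
Proof.
elim/Localization.fracW: x => a s nu; exists a, s; split=> // c ac /=.
exists c, mone; split; rewrite ?mulm1 //; apply/eqP => c1; subst c.
apply: nu; rewrite -pE in ac.
exists (frac (sval s) (exist _ a ac)); rewrite Localization.fracM.
rewrite -Localization.frac1; apply: Localization.frac_eq => /=.
by rewrite mulr1 mul1r mulrC.
Qed.

Lemma monom_nonunit c : c != mone -> nonunits (frac << c >> denom1).
Proof.
move=> c1 [y]; elim/Localization.fracW: y => a s.
rewrite Localization.fracM -Localization.frac1 => /Localization.fracP[u up /= e].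
have := congr1 (mcoeff mone) e; rewrite mulr1 mul1r.
have -> : mcoeff mone (u * (<< c >> * a)) = 0.
  rewrite !rmorphM /= mcoeffU1 (negPf c1).
  by rewrite mul0r mulr0.
move/esym/eqP; rewrite rmorphM /= mulf_eq0 mcoeffCM mul1r -!pE.
by rewrite (negPf up) (negPf (valP s)).
Qed.

Lemma ideal_pow_monom n :
  (ideal_pow (@nonunits O) n `<=` monom_ideal (factors n))%classic.
Proof.
move=> x [m [a [y [yI ->]]]].
have fI : is_ideal (monom_ideal (factors n)).
  by apply: monom_ideal_is_ideal => c d; apply: factorsMl.
case: (fI) => f0 fD fM.
elim/big_ind: _ => // j _; apply: fM.
have {}yI i : nonunits (y j i) by [].
move: (y j) yI => {f0 fD fI m a} y {}j.
elim: n y j => [|n IH] y j; first by rewrite big_ord0; apply: monom_idealT.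
rewrite big_ord_recl; apply: monom_idealM (nonunit_monom (j _)) (IH _ _) => //.
move=> c d [g [c' [g1 _ ->]]] dn /=; exists g, (mmul c' d); split => //.
  exact: factorsMl.
by rewrite mulmA.
Qed.

Lemma monom_ideal_pow n c : factors n c ->
  ideal_pow (@nonunits O) n (frac << c >> denom1).
Proof.
elim: n c => [|n IH] c.
  exists 1%N, (fun=> frac << c >> denom1), (fun _ _ => 0); split;
    first by move=> _ [].
  by rewrite big_ord1 big_ord0 mulr1.
move=> [g [d [g1 /IH[m [a [y [yI yE]]]] ->]]].
exists m, a, (fun j i => if unlift ord0 i is Some i' then y j i' else frac << g
  >> denom1).
split=> [j i|]; first by case: unliftP => // _; apply: monom_nonunit.
transitivity (frac << g >> denom1 * frac << d >> denom1).
  rewrite Localization.fracM; apply: Localization.frac_eq => /=.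
  by rewrite !mulr1 malgM_def fgmulUU mulr1.
rewrite yE mulr_sumr; apply: eq_bigr => j _.
rewrite big_ord_recl unlift_none mulrCA; congr (_ * (_ * _)).
by apply: eq_bigr => i _; rewrite liftK.
Qed.

Lemma fracD1 a b : frac (a + b) denom1 = frac a denom1 + frac b denom1.
Proof.
by rewrite Localization.fracD; apply: Localization.frac_eq; rewrite /= !mulr1.
Qed.

Lemma fracM1 a b : frac (a * b) denom1 = frac a denom1 * frac b denom1.
Proof.
by rewrite Localization.fracM; apply: Localization.frac_eq; rewrite /= !mulr1.
Qed.

Section Chains.
Variables (n : nat) (L : seq M).
Hypothesis L_uniq : uniq L.
Hypothesis memL : forall c, c \in L <-> ~ factors n c.

Lemma ideal_frac_sum (I : set O) (J : Type) (r : seq J) (P : pred J) (F : J -> A) :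
  is_ideal I -> (forall j, P j -> I (frac (F j) denom1)) ->
  I (frac (\sum_(j <- r | P j) F j) denom1).
Proof.
move=> [I0 ID IM] FI; elim/big_ind: _ => //.
by move=> a b aI bI; rewrite fracD1; apply: ID.
Qed.

Lemma ideal_fracZ (I : set O) (x : k) (f : A) : is_ideal I ->
  I (frac f denom1) -> I (frac (x *: f) denom1).
Proof. by move=> [I0 ID IM] fI; rewrite -mul_malgC fracM1; apply: IM. Qed.

(** Multiplying by a unit of O clears the denominator, and the monomials in the
    n-th power of the maximal ideal may be dropped: strict inclusion is
    witnessed by a linear combination of the finitely many remaining ones. *)
Lemma chain_witness (I J : set O) : is_ideal I -> is_ideal J ->
  (ideal_pow (@nonunits O) n `<=` I)%classic -> (I `<` J)%classic ->
  exists v : A, [/\ forall c, c \notin L -> mcoeff c v = 0,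
    J (frac v denom1) & ~ I (frac v denom1)].
Proof.
move=> Ii Ji powI [IJ nJI].
have [x [Jx nIx]] : exists x, J x /\ ~ I x.
  by apply: contrapT => /forallNP h; apply: nJI => x Jx;
     apply: contrapT => nIx; apply: (h x).
elim/Localization.fracW: x Jx nIx => a s Jx nIx.
have Ja : J (frac a denom1).
  have [_ _ JM] := Ji; have := JM (frac (sval s) denom1) _ Jx.
  rewrite Localization.fracM; congr J; apply: Localization.frac_eq => /=.
  by rewrite mulr1 mul1r mulrC.
have nIa : ~ I (frac a denom1).
  have [_ _ IM] := Ii => /(IM (frac 1 s)) Ia; apply: nIx; move: Ia.
  by rewrite Localization.fracM; congr I; apply: Localization.frac_eq => /=; ring.
pose b := \sum_(c <- finmap.enum_fset (msupp a) | c \notin L) << mcoeff c a *g c >>.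
have Ib : I (frac b denom1).
  apply: ideal_frac_sum => // c cL.
  have cn : factors n c by apply: contrapT => /memL; apply/negP.
  have -> : << mcoeff c a *g c >> = mcoeff c a *: (<< c >> : A).
    by apply/malgP => d; rewrite mcoeffZ !mcoeffU mulrnAr mulr1.
  by apply: ideal_fracZ => //; apply: powI; apply: monom_ideal_pow.
have abE : a - b = \sum_(c <- finmap.enum_fset (msupp a) | c \in L) << mcoeff c a
  *g c >>.
  by rewrite {1}[a]monalgE (bigID (mem L)) /= addrK.
exists (a - b); split.
- move=> c cL; rewrite abE raddf_sum big1 // => d dL /=.
  by rewrite mcoeffU; case: eqP => [dc|//]; rewrite -dc dL in cL.
- have [_ JD _] := Ji; rewrite -[- b]scaleN1r fracD1; apply: JD => //.
  by apply: ideal_fracZ => //; exact: IJ.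
- move=> Iab; apply: nIa; rewrite -[a](subrK b) fracD1.
  by case: Ii => _ ID _; apply: ID.
Qed.

(** Take a witness for each step of the chain. If there were more of them than
    monomials in L, they would be linearly dependent, and the last witness in a
    dependency would lie in an ideal that it was chosen to avoid. *)
Lemma chain_length_le r I : ideal_chain (ideal_pow (@nonunits O) n) r I ->
  (r <= size L)%N.
Proof.
move=> [powI Iideal Istrict].
have Imono i j : (i <= j <= r)%N -> (I i `<=` I j)%classic.
  elim: j => [|j IH] /andP[]; first by rewrite leqn0 => /eqP -> _ x.
  rewrite leq_eqVlt => /orP[/eqP -> _ x //|ij] jr x Ix.
  have [IJ _] := Istrict j jr; apply: IJ; apply: (IH _ x Ix).
  by move: ij; rewrite ltnS => ->; rewrite ltnW.
have /choice[v vP] : forall i : 'I_r, exists v : A,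
    [/\ forall c, c \notin L -> mcoeff c v = 0,
     I i.+1 (frac v denom1) & ~ I i (frac v denom1)].
  move=> i; apply: chain_witness;
    [exact/Iideal/ltnW|exact: Iideal| |exact: Istrict].
  by apply: subset_trans powI _; apply: Imono; rewrite leq0n ltnW.
rewrite leqNgt; apply/negP => hr.
pose W : 'M[k]_(r, size L) := \matrix_(i, j) mcoeff (nth mone L j) (v i).
have : kermx W != 0.
  rewrite -mxrank_eq0 mxrank_ker subn_eq0 -ltnNge.
  exact: leq_ltn_trans (rank_leq_col _) hr.
case/rowV0Pn => u /sub_kermxP uW u0.
have [i0 ui0] : exists i, u 0 i != 0.
  apply/existsP; move: u0; apply: contraNT => /existsPn u0.
  by apply/eqP/rowP => i; rewrite mxE; apply/eqP; have := u0 i; rewrite negbK.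
case: (@arg_maxnP _ i0 (fun i => u 0 i != 0) (@nat_of_ord r) ui0) => i ui imax.
have uv0 : \sum_j u 0 j *: v j = 0.
  apply/malgP => c; rewrite mcoeff0 raddf_sum /=.
  case: (boolP (c \in L)) => cL; last first.
    by rewrite big1 // => j _; rewrite mcoeffZ; case: (vP j) => -> //;
      rewrite mulr0.
  have := congr1 (fun X : 'rV_(size L) =>
    X 0 (Ordinal (etrans (index_mem c L) cL))) uW.
  rewrite !mxE => e; rewrite -[RHS]e; apply: eq_bigr => j _.
  by rewrite mcoeffZ mxE /= nth_index.
have [_ _ /(_ _)] := vP i; apply.
have -> : v i = \sum_(j | j != i) (- (u 0 i)^-1 * u 0 j) *: v j.
  move/eqP: uv0; rewrite (bigD1 i) //= addr_eq0 => /eqP.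
  move/(congr1 (fun x => (u 0 i)^-1 *: x)); rewrite scalerA mulVf // scale1r => ->.
  rewrite scalerN -scaleNr scaler_sumr; apply: eq_bigr => j _; by rewrite scalerA.
apply: ideal_frac_sum => [|j ji]; first exact/Iideal/ltnW.
have [->|uj] := eqVneq (u 0 j) 0.
  by rewrite mulr0 scale0r; case: (Iideal i (ltnW (ltn_ord i))).
apply: ideal_fracZ; first exact/Iideal/ltnW.
have ji' : (j < i)%N by rewrite ltn_neqAle ji; apply: imax.
have [_ Ij _] := vP j; apply: Imono Ij; rewrite ji' ltnW//.
Qed.

Hypothesis L_sorted : sorted (fun c d => (deg d <= deg c)%N) L.

(** The monomials in the n-th power of the maximal ideal together with the first
    i entries of L. As L is sorted by decreasing degree, this set is closed
    under multiplication by monomials. *)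
Definition chain_set (i : nat) (c : M) : Prop :=
  factors n c \/ (c \in L) && (index c L < i)%N.

Lemma chain_set_ideal i c d : chain_set i d -> chain_set i (mmul c d).
Proof.
move=> [dn|/andP[dL id]]; first by left; apply: factorsMl.
case: (eqVneq c mone) => [->|c1]; first by rewrite mul1m; right; rewrite dL.
have [|cdn] := pselect (factors n (mmul c d)); first by left.
have cdL : mmul c d \in L by apply/memL.
right; rewrite cdL; apply: leq_ltn_trans id; rewrite leqNgt; apply/negP => lt.
have tr : transitive (fun c d => (deg d <= deg c)%N).
  by move=> x y z yx zy; exact: leq_trans zy yx.
have := sorted_ltn_nth tr mone L_sorted (index d L) (index (mmul c d) L).
rewrite !inE !index_mem !nth_index // => /(_ dL cdL lt).
by rewrite degM; have := deg_gt0 c1; lia.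
Qed.

Lemma chain_exists : exists I, ideal_chain (ideal_pow (@nonunits O) n) (size L) I.
Proof.
exists (fun i => monom_ideal (chain_set i)); split.
- apply: subset_trans (@ideal_pow_monom n) _.
  by apply: monom_idealS => c; left.
- move=> i _; apply: monom_ideal_is_ideal; exact: chain_set_ideal.
- move=> i iL; split.
    apply: monom_idealS => c [|/andP[cL ci]]; [by left|right].
    by rewrite cL ltnW.
  pose c := nth mone L i; have cL : c \in L by apply: mem_nth.
  have ci : index c L = i by apply: index_uniq.
  move/(_ (frac << c >> denom1)).
  rewrite (monom_in_ideal _ (@chain_set_ideal i)).
  rewrite (monom_in_ideal _ (@chain_set_ideal i.+1)) => h.
  case: h; first by right; rewrite cL ci /=.
    by apply/memL.
  by rewrite ci ltnn andbF.
Qed.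

End Chains.

Lemma quotient_length_monom n (L : seq M) : uniq L ->
  (forall c, c \in L <-> ~ factors n c) ->
  quotient_length (ideal_pow (@nonunits O) n) (size L).
Proof.
move=> uL memL; pose le c d := (deg d <= deg c)%N.
have mem_sort c : c \in sort le L <-> ~ factors n c.
  by rewrite path.mem_sort; apply: memL.
split; last by move=> r I; apply: chain_length_le.
rewrite -(size_sort le); apply: chain_exists => //; first by rewrite sort_uniq.
by apply: sort_sorted => x y; rewrite /le; apply: leq_total.
Qed.

End Length.

(** * Lattice points and Lebesgue measure *)

Local Open Scope classical_set_scope.
Local Open Scope ring_scope.
Import ArrowAsProduct.

Section Cubes.
Variable R : realType.
Local Notation Rn d := (d.-tuple (measurableTypeR R)).

Definition cube d (a : 'I_d -> R) (l : R) : set (Rn d) :=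
  [set t | forall i, a i <= tnth t i < a i + l].

Lemma measurable_cube d (a : 'I_d -> R) l : measurable (cube a l).
Proof.
have -> : cube a l = \bigcap_(i in [set: 'I_d])
    ((fun t : Rn d => tnth t i) @^-1` [set` `[a i, a i + l[ ]).
  apply/seteqP; split=> [t ta i _|t ta i].
    by rewrite /= in_itv /=; apply: ta.
  by have := ta i I; rewrite /= in_itv.
apply: fin_bigcap_measurable => [|i _]; first exact: finite_finset.
rewrite -[X in measurable X]setTI; apply: measurable_tnth => //.
Qed.

(** Fubini, one coordinate at a time. *)
Lemma measure_cube d (a : 'I_d -> R) l : 0 <= l ->
  tuple_lebesgue R d (cube a l) = (l ^+ d)%:E.
Proof.
move=> l0; elim: d a => [|d IH] a.
  rewrite /= diracE mem_set // => -[i]; by [].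
rewrite /= /cons_measure /pushforward.
have -> : @cons_pair R d @^-1` cube a l =
    [set` `[a ord0, a ord0 + l[ ] `*` cube (fun i => a (lift ord0 i)) l.
  apply/seteqP; split=> [[x t] xt|[x t] [/= xa ta] i].
    split; first by have := xt ord0; rewrite /= in_itv.
    by move=> i; have := xt (lift ord0 i); rewrite /cons_pair /= tnthS.
  case: (unliftP ord0 i) => [j|] -> /=; first by rewrite /cons_pair tnthS;
    apply: ta.
  by move: xa; rewrite in_itv.
rewrite product_measure1E //; last exact: measurable_cube.
rewrite IH exprS EFinM; congr (_ * _)%E.
apply: etrans (lebesgue_measure_itv _) _ => /=; rewrite lte_fin ltrDl.
case: ltgtP l0 => // [l0 _|<- _ //].
by rewrite -EFinD addrAC subrr add0r.
Qed.

Local Notation Z d := {ffun 'I_d -> int}.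

(** The cube of side 1/n with corner z/n, written without division. *)
Definition cell d (n : nat) (z : Z d) : set (Rn d) :=
  [set t | forall i, (z i)%:~R <= n%:R * tnth t i < (z i)%:~R + 1].

Lemma cell_cube d n (z : Z d) : (0 < n)%N ->
  cell n z = cube (fun i => (z i)%:~R / n%:R) n%:R^-1.
Proof.
move=> n0; have n0' : 0 < n%:R :> R by rewrite ltr0n.
have E (a x : R) : (a / n%:R <= x < a / n%:R + n%:R^-1) = (a <= n%:R * x < a + 1).
  by rewrite -[X in _ + X]div1r -mulrDl ler_pdivrMr // ltr_pdivlMr // ![_ *
    n%:R]mulrC.
by apply/seteqP; split=> t tz i; have := tz i; rewrite E.
Qed.

Lemma measurable_cell d n (z : Z d) : (0 < n)%N -> measurable (cell n z).
Proof. by move=> n0; rewrite cell_cube //; apply: measurable_cube. Qed.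

Lemma measure_cell d n (z : Z d) : (0 < n)%N ->
  tuple_lebesgue R d (cell n z) = (n%:R ^- d)%:E.
Proof. by move=> n0; rewrite cell_cube // measure_cube ?invr_ge0 // exprVn. Qed.

Definition cell_index d (n : nat) (t : Rn d) : Z d :=
  [ffun i => Num.floor (n%:R * tnth t i : R)].

Lemma cell_cell_index d n (t : Rn d) : cell n (cell_index n t) t.
Proof.
move=> i; rewrite ffunE floor_le_tmp.
by rewrite -[1]/(1%:~R) -intrD floorD1_gt.
Qed.

Lemma cell_inj d n (z w : Z d) t : cell n z t -> cell n w t -> z = w.
Proof.
move=> tz tw; apply/ffunP => i.
have /andP[z1 z2] := tz i; have /andP[w1 w2] := tw i.
have := le_lt_trans z1 w2; have := le_lt_trans w1 z2.
rewrite -[1]/(1%:~R) -!intrD !ltr_int.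
by move: (z i) (w i) => a b; lia.
Qed.

Definition cells d n (s : seq (Z d)) : set (Rn d) :=
  \big[setU/set0]_(z <- s) cell n z.

Lemma cellsP d n (s : seq (Z d)) t : cells n s t <-> exists2 z,
  z \in s & cell n z t.
Proof.
rewrite /cells; elim: s => [|z s IH]; first by rewrite big_nil; split=> // -[].
rewrite big_cons; split=> [[tz|/IH[w ws tw]]|[w]].
- by exists z; rewrite ?mem_head.
- by exists w; rewrite // inE ws orbT.
- by rewrite inE => /orP[/eqP ->|ws tw]; [left|right; apply/IH; exists w].
Qed.

Lemma measurable_cells d n (s : seq (Z d)) : (0 < n)%N -> measurable (cells n s).
Proof.
by move=> n0; apply: bigsetU_measurable => z _; apply: measurable_cell.
Qed.

Lemma measure_cells d n (s : seq (Z d)) : (0 < n)%N -> uniq s ->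
  tuple_lebesgue R d (cells n s) = ((size s)%:R * n%:R ^- d)%:E.
Proof.
move=> n0; elim: s => [_|z s IH /= /andP[zs us]].
  by rewrite /cells big_nil measure0 mul0r.
have -> : cells n (z :: s) = cell n z `|` cells n s by rewrite /cells big_cons.
transitivity (tuple_lebesgue R d (cell n z) + tuple_lebesgue R d (cells n s))%E.
  apply: measureU; [exact: measurable_cell|exact: measurable_cells|].
  apply/seteqP; split=> // t [tz /cellsP[w ws tw]].
  by move: zs; rewrite (cell_inj tz tw) ws.
by rewrite IH // measure_cell // -EFinD -natr1 mulrDl mul1r addrC.
Qed.

(** Outside B the count S and the set K agree on each cube. The union of the
    cubes in S but not in B lies in K, and the cubes in S or B cover K. *)
Lemma cells_sandwich d n (S B : seq (Z d)) (K : set (Rn d)) :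
  (0 < n)%N -> uniq S -> measurable K ->
  (forall z, z \in S -> z \notin B -> cell n z `<=` K) ->
  (forall z t, z \notin S -> z \notin B -> cell n z t -> ~ K t) ->
  tuple_lebesgue R d K \is a fin_num /\
  `|(size S)%:R - fine (tuple_lebesgue R d K) * n%:R ^+ d| <= (size B)%:R :> R.
Proof.
move=> n0 uS mK inK outK.
pose S1 := [seq z <- S | z \notin B]; pose S2 := undup (S ++ B).
have nd0 : 0 < n%:R ^+ d :> R by rewrite exprn_gt0 // ltr0n.
have h1 : cells n S1 `<=` K.
  by move=> t /cellsP[z]; rewrite mem_filter => /andP[zB zS]; apply: inK.
have h2 : K `<=` cells n S2.
  move=> t Kt; apply/cellsP; exists (cell_index n t); last exact: cell_cell_index.
  rewrite mem_undup mem_cat; apply: contraT; rewrite negb_or => /andP[zS zB].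
  by have := outK _ t zS zB (cell_cell_index _ _).
have m1 : (((size S1)%:R * n%:R ^- d)%:E <= tuple_lebesgue R d K)%E.
  rewrite -measure_cells ?filter_uniq //.
  by apply: le_measure; rewrite ?inE //; apply: measurable_cells.
have m2 : (tuple_lebesgue R d K <= ((size S2)%:R * n%:R ^- d)%:E)%E.
  rewrite -measure_cells ?undup_uniq //.
  by apply: le_measure; rewrite ?inE //; apply: measurable_cells.
have fK : tuple_lebesgue R d K \is a fin_num.
  by rewrite ge0_fin_numE //; apply: le_lt_trans m2 (ltry _).
split=> //; move: m1 m2; rewrite -(fineK fK) !lee_fin.
rewrite ler_pdivrMr // ler_pdivlMr //=; set V := fine _ * _.
move=> m1 m2.
have s1 : (size S)%:R <= (size S1)%:R + (size B)%:R :> R.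
  rewrite -natrD ler_nat -(count_predC (mem B) S) addnC size_filter leq_add2l.
  by rewrite -size_filter; apply: uniq_leq_size; rewrite ?filter_uniq // => z;
    rewrite mem_filter => /andP[].
have s2 : (size S2)%:R <= (size S)%:R + (size B)%:R :> R.
  by rewrite -natrD ler_nat -size_cat size_undup.
by rewrite ler_norml; apply/andP; split; lra.
Qed.

Definition lattice_box d (r : nat) : seq (Z d) :=
  [seq [ffun i => (f i)%:Z - r%:Z] | f : {ffun 'I_d ->
    'I_(r + r).+1} <- enum {ffun 'I_d -> 'I_(r + r).+1}].

Lemma mem_lattice_box d r (z : Z d) :
  reflect (forall i, (`|z i| <= r)%N) (z \in lattice_box d r).
Proof.
apply: (iffP mapP) => [[f _ ->] i|zr].
  by rewrite ffunE; have := ltn_ord (f i); move: (nat_of_ord (f i)) => a; lia.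
exists [ffun i => inord (absz (z i + r%:Z))]; first by rewrite mem_enum.
apply/ffunP => i; rewrite !ffunE inordK; have := zr i; move: (z i) => y; lia.
Qed.

Lemma size_lattice_box d r : size (lattice_box d r) = ((r + r).+1 ^ d)%N.
Proof. by rewrite size_map -cardE card_ffun !card_ord. Qed.

(** For any K' the translates of T n by 0, c + 1, ..., (K' - 1)(c + 1) times w are
    disjoint. They lie in a box whose side is proportional to n as soon as n is
    large compared with K', so that K' times the size of T n is at most a
    constant times n^d. *)
Lemma thin_count d (M c : nat) (w : Z d) (T : nat -> seq (Z d)) :
  (forall n, uniq (T n)) ->
  (forall n z, z \in T n -> forall i, (`|z i| <= M * n)%N) ->
  (forall n z k, (0 < n)%N -> (c < k)%N -> z \in T n -> z + w *+ k \notin T n) ->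
  forall K, exists n0, forall n, (n0 <= n)%N -> (K * size (T n) <= n ^ d)%N.
Proof.
move=> uT bT thin K.
(* The factor (2M + 1)^d cancels the size of the box. *)
pose K' := (K * (M + M).+1 ^ d)%N.
pose W := (\sum_i `|w i|)%N.
exists (2 * (K' * c.+1 * W)).+1 => n nn0.
have n0 : (0 < n)%N by apply: leq_trans nn0.
pose U := [seq z + w *+ (j * c.+1) | j <- iota 0 K', z <- T n].
have shift_ne (i j : nat) z y : z \in T n -> y \in T n -> (i < j)%N ->
    z + w *+ (i * c.+1) = y + w *+ (j * c.+1) -> False.
  move=> zT yT ij e; have zE : z = y + w *+ ((j - i) * c.+1).
    apply: (addIr (w *+ (i * c.+1))); rewrite e -addrA -mulrnDr -mulnDl subnK //.
    exact: ltnW.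
  have ck : (c < (j - i) * c.+1)%N by nia.
  by have := thin n y _ n0 ck yT; rewrite -zE zT.
have uU : uniq U.
  apply: allpairs_uniq; rewrite ?iota_uniq //.
  move=> [i z] [j y] /allpairsP[[i' z'] [_ zT [-> ->]]] /allpairsP[[j' y'] [_ yT
    [-> ->]]] /=.
  rewrite /= in zT yT; case: (ltngtP i' j') => [ij|ji|<-] e.
  - by case: (shift_ne _ _ _ _ zT yT ij e).
  - by case: (shift_ne _ _ _ _ yT zT ji (esym e)).
  - by rewrite (addIr _ e).
have sub : {subset U <= lattice_box d (M * n + K' * c.+1 * W)}.
  move=> _ /allpairsP[[j z] [/= jK zT ->]]; apply/mem_lattice_box => i.
  rewrite mem_iota add0n /= in jK.
  have wi : (`|w i| <= W)%N by rewrite /W (bigD1 i) //= leq_addr.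
  rewrite ffunE ffunMnE.
  apply: leq_trans (_ : `|z i| + `|(w i *+ (j * c.+1))%R| <= _)%N.
    by move: (z i) (w i *+ _) => a b; lia.
  apply: leq_add; first exact: bT.
  rewrite -mulr_natr abszM natz absz_nat mulnC; apply: leq_mul => //.
  by rewrite leq_mul2r ltnW.
have := uniq_leq_size uU sub; rewrite size_allpairs size_iota size_lattice_box => h.
have {}h : (K' * size (T n) <= ((M + M).+1 * n) ^ d)%N.
  apply: leq_trans h _; case: (posnP d) => [->//|d0].
  rewrite leq_exp2r //; nia.
rewrite expnMn in h.
rewrite -(@leq_pmul2l ((M + M).+1 ^ d)) ?expn_gt0 //.
by rewrite mulnA [(_ ^ d * K)%N]mulnC.
Qed.
End Cubes.

Section Jordan.
Variables (R : realType) (d : nat).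
Local Notation Rn := (d.-tuple (measurableTypeR R)).
Local Notation Z := {ffun 'I_d -> int}.

(** A family of sets of lattice points, indexed by the scale n, that meets each
    line in direction w in a stretch of length bounded independently of n. *)
Definition thin (w : Z) (c : nat) (P : nat -> Z -> Prop) :=
  forall n z k, (0 < n)%N -> (c < k)%N -> P n z -> ~ P n (z + w *+ k).

(** Two families P1 and P2 are allowed because the union of two thin families
    need not be thin. *)
Lemma lattice_count_cvg (S : nat -> seq Z) (K : set Rn) (M c : nat) (w : Z)
    (P1 P2 : nat -> Z -> Prop) :
  (forall n, uniq (S n)) -> measurable K -> thin w c P1 -> thin w c P2 ->
  (forall n z t, (0 < n)%N -> z \in S n -> cell n z t -> ~ K t ->
    P1 n z \/ P2 n z) ->
  (forall n z t, (0 < n)%N -> z \notin S n -> cell n z t -> K t ->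
    P1 n z \/ P2 n z) ->
  (forall n z, (0 < n)%N -> z \in S n -> z \in lattice_box d (M * n)) ->
  (forall n z t, (0 < n)%N -> cell n z t -> K t -> z \in lattice_box d (M * n)) ->
  tuple_lebesgue R d K \is a fin_num /\
  (size (S n))%:R / n%:R ^+ d @[n --> \oo] --> fine (tuple_lebesgue R d K).
Proof.
move=> uS mK thin1 thin2 inK outK boxS boxK.
pose T (P : nat -> Z -> Prop) n :=
  [seq z <- undup (lattice_box d (M * n)) | `[<P n z>]].
pose B n := [seq z <- undup (lattice_box d (M * n)) | `[<P1 n z \/ P2 n z>]].
have BT n : (size (B n) <= size (T P1 n) + size (T P2 n))%N.
  rewrite -size_cat; apply: uniq_leq_size; first by rewrite filter_uniq ?undup_uniq.
  move=> z; rewrite mem_cat !mem_filter => /andP[/asboolP[P1z|P2z] ->];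
    rewrite !andbT.
    by apply/orP; left; apply/asboolP.
  by apply/orP; right; apply/asboolP.
have Tsmall P : thin w c P ->
    forall k, exists n0, forall n, (n0 <= n)%N -> (k * size (T P n) <= n ^ d)%N.
  move=> thinP; apply: (@thin_count d M c w (T P)).
  - by move=> n; rewrite filter_uniq ?undup_uniq.
  - by move=> n z; rewrite mem_filter mem_undup => /andP[_ /mem_lattice_box].
  - move=> n z k n0 ck; rewrite mem_filter => /andP[/asboolP Pz _].
    by rewrite mem_filter negb_and; apply/orP; left; apply/asboolPn; apply: thinP.
have sandwich n : (0 < n)%N -> tuple_lebesgue R d K \is a fin_num /\
    `|(size (S n))%:R - fine (tuple_lebesgue R d K) * n%:R ^+ d| <= (size (B
      n))%:R :> R.
  move=> n0; apply: cells_sandwich => //.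
    move=> z zS zB t tz; apply: contrapT => Kt; move/negP: zB; apply.
    by rewrite mem_filter mem_undup boxS // andbT; apply/asboolP; apply: inK tz Kt.
  move=> z t zS zB tz Kt; move/negP: zB; apply.
  by rewrite mem_filter mem_undup (boxK n z t) // andbT; apply/asboolP;
    apply: outK tz Kt.
split; first by have [] := sandwich 1%N isT.
set V := fine _; apply/cvgrPdist_le => e e0.
pose k := (Num.truncn (2 / e)).+1.
have ke : 2 / k%:R <= e.
  rewrite ler_pdivrMr // mulrC -ler_pdivrMr // ltW //.
  by have /truncn_itv/andP[] : 0 <= 2 / e by rewrite divr_ge0 // ltW.
have [n1 H1] := Tsmall _ thin1 k; have [n2 H2] := Tsmall _ thin2 k.
exists (maxn 1 (maxn n1 n2)) => // n; rewrite /= !geq_max => /and3P[n0 n1n n2n].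
have nd0 : 0 < n%:R ^+ d :> R by rewrite exprn_gt0 // ltr0n.
have [_] := sandwich n n0; rewrite -/V => h.
have -> : V - (size (S n))%:R / n%:R ^+ d =
    - (((size (S n))%:R - V * n%:R ^+ d) / n%:R ^+ d).
  by rewrite mulrBl mulfK ?gt_eqF // opprB.
rewrite normrN normrM normfV (ger0_norm (ltW nd0)) ler_pdivrMr // (le_trans h) //.
apply: le_trans (_ : 2 / k%:R * n%:R ^+ d <= _); last by rewrite ler_pM2r.
rewrite mulrAC ler_pdivlMr //.
have : (size (B n) * k <= 2 * n ^ d)%N.
  by have := H1 n n1n; have := H2 n n2n; have := BT n; nia.
by rewrite -(ler_nat R) !natrM natrX.
Qed.

(** A cube of small side around a point of the open complement stays in the
    complement, so the complement is a countable union of cubes. *)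
Lemma measurable_of_open (K : set Rn) :
  (forall t, ~ K t -> exists2 e : R, 0 < e &
     forall u, (forall i, `|tnth t i - tnth u i| < e) -> ~ K u) -> measurable K.
Proof.
move=> openK.
have -> : K = ~` \bigcup_n cells n.+1
    [seq z <- lattice_box d (n.+1 * n.+1) | `[< forall t, cell n.+1 z t ->
      ~ K t >]].
  apply/seteqP; split=> [t Kt [n _ /cellsP[z]]|t].
    by rewrite mem_filter => /andP[/asboolP zK _] /zK.
  move=> nt; apply: contrapT => Kt; apply: nt.
  have [e e0 eK] := openK t Kt.
  pose a := \sum_i `|tnth t i|.
  pose n := Num.truncn (e^-1 + a + 1).
  have a0 : 0 <= a by rewrite sumr_ge0.
  have nE : e^-1 + a + 1 < n.+1%:R.
    have /truncn_itv/andP[] // : 0 <= e^-1 + a + 1.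
    by rewrite !addr_ge0 // invr_ge0 ltW.
  have ie0 : 0 < e^-1 by rewrite invr_gt0.
  exists n => //; apply/cellsP; exists (cell_index n.+1 t);
    last exact: cell_cell_index.
  rewrite mem_filter; apply/andP; split.
    apply/asboolP => u uc; apply: eK => i.
    have := uc i; have := cell_cell_index n.+1 t i.
    set z := (_ %:~R : R) => /andP[z1 z2] /andP[z3 z4].
    have nl : 1 < n.+1%:R * e by rewrite -ltr_pdivrMr // div1r; lra.
    have n0 : 0 < n.+1%:R :> R by [].
    rewrite -(ltr_pM2l n0) -[X in X * `|_|]ger0_norm ?ltW // -normrM mulrBr.
    apply: lt_trans nl; rewrite ltr_norml; apply/andP; split; lra.
  apply/mem_lattice_box => i; rewrite ffunE.
  have ta : `|tnth t i| <= a by rewrite /a (bigD1 i) //= lerDl sumr_ge0.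
  have tn : `|tnth t i| <= n%:R by move: nE; rewrite -natr1; lra.
  have n1 : 0 <= n.+1%:R :> R by [].
  suff : (- (n.+1 * n.+1)%N%:Z <= Num.floor (n.+1%:R * tnth t i : R) <= (n.+1 *
    n)%N%:Z).
    by move: (Num.floor _) => f; lia.
  apply/andP; split; last first.
    rewrite -(ler_int R) (le_trans (floor_le_tmp _)) //.
    by rewrite -pmulrn natrM ler_wpM2l // (le_trans _ tn) // ler_norm.
  rewrite floor_ge_int // mulrNz -pmulrn natrM -mulrN ler_wpM2l //.
  rewrite lerNl (le_trans _ (le_trans tn _)) // ?ler_nat //.
  by rewrite -normrN ler_norm.
apply: measurableC; apply: bigcupT_measurable => n; exact: measurable_cells.
Qed.

End Jordan.

(** * Leading coefficients and the standard simplex *)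

Section PolyLimit.
Variable R : realType.

Lemma cvg_invn : (n%:R^-1 : R) @[n --> \oo] --> (0 : R).
Proof. by rewrite -cvg_shiftS; exact: cvg_harmonic. Qed.

Lemma cvg_horner_invn (q : {poly R}) : q.[n%:R^-1] @[n --> \oo] --> q.[0].
Proof.
apply: (@cvg_comp _ _ _ (fun n : nat => n%:R^-1 : R) (horner q) _ _ _ cvg_invn).
exact: continuous_horner.
Qed.

(** p(n)/n^d is the value at 1/n of the reversed polynomial. *)
Lemma poly_cvg_coef (p : {poly R}) d : (size p <= d.+1)%N ->
  p.[n%:R] / n%:R ^+ d @[n --> \oo] --> p`_d.
Proof.
move=> sp; pose q : {poly R} := \sum_(i < d.+1) p`_i *: 'X^(d - i).
have -> : p`_d = q.[0].
  rewrite /q horner_sum big_ord_recr /= subnn hornerZ hornerXn expr0 mulr1.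
  rewrite big1 ?add0r // => i _; rewrite hornerZ hornerXn expr0n subn_eq0.
  by rewrite leqNgt ltn_ord mulr0.
have : q.[n%:R^-1] @[n --> \oo] --> q.[0] by exact: cvg_horner_invn.
apply: cvg_trans; apply: near_eq_cvg; exists 1%N => // n /= n0.
have n0' : n%:R != 0 :> R by rewrite pnatr_eq0 -lt0n.
rewrite (horner_coef_wide _ sp) horner_sum mulr_suml; apply: eq_bigr => i _.
rewrite hornerZ hornerXn exprVn -mulrA; congr (_ * _).
have id : (i <= d)%N by rewrite -ltnS.
apply: (@mulfI _ (n%:R ^+ (d - i))); first exact: expf_neq0.
rewrite divff ?expf_neq0 // mulrA -exprD subnK // divff ?expf_neq0 //.
Qed.

(** A polynomial of degree e behaves like its leading coefficient times n^e, so
    a finite nonzero limit forces e = d. *)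
Lemma poly_of_cvg (p : {poly R}) d (V : R) : V != 0 ->
  p.[n%:R] / n%:R ^+ d @[n --> \oo] --> V -> size p = d.+1 /\ lead_coef p = V.
Proof.
move=> V0 pV.
have [sp|sp] := leqP (size p) d.+1.
  have pd : p`_d = V by apply: cvg_unique (poly_cvg_coef sp) pV.
  have sE : size p = d.+1.
    apply/eqP; rewrite eqn_leq sp ltnNge; apply: contra V0 => ps.
    by rewrite -pd nth_default.
  by rewrite lead_coefE sE.
exfalso; pose m := (size p).-1.
have mE : size p = m.+1 by rewrite prednK //; apply: leq_trans sp.
have dm : (d < m)%N by rewrite -ltnS -mE.
have h1 := @poly_cvg_coef p m; rewrite mE in h1; have {}h1 := h1 (leqnn _).
have h2 : p.[n%:R] / n%:R ^+ m @[n --> \oo] --> V * ('X^(m - d)).[0].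
  have : p.[n%:R] / n%:R ^+ d * ('X^(m - d)).[n%:R^-1] @[n --> \oo] -->
      V * ('X^(m - d)).[0] by apply: cvgM pV _; exact: cvg_horner_invn.
  apply: cvg_trans; apply: near_eq_cvg; exists 1%N => // n /= n0.
  rewrite /= hornerXn exprVn -mulrA -invfM -exprD; congr (_ / (_ ^+ _)); lia.
have : p`_m = V * ('X^(m - d)).[0] by apply: cvg_unique h1 h2.
rewrite hornerXn expr0n subn_eq0 leqNgt dm mulr0 => pm.
have : lead_coef p = 0 by rewrite lead_coefE.
by move/eqP; rewrite lead_coef_eq0 => /eqP p0; move: sp; rewrite p0 size_poly0.
Qed.

End PolyLimit.

Section Simplex.
Variables (R : realType) (d : nat).
Local Notation Rn := (d.-tuple (measurableTypeR R)).
Local Notation Z := {ffun 'I_d -> int}.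

Definition simplex : set Rn :=
  [set t | (forall i, 0 <= tnth t i) /\ \sum_i tnth t i <= 1].

Lemma measurable_simplex : measurable simplex.
Proof.
apply: measurable_of_open => t /not_andP[/existsNP[i /negP]|/negP].
  rewrite -ltNge => ti; exists (- tnth t i) => [|u tu [/(_ i) ui _]].
    by rewrite oppr_gt0.
  by have := tu i; rewrite ltr_norml => /andP[]; lra.
rewrite -ltNge => t1; pose e := (\sum_i tnth t i - 1) / d.+1%:R.
have e0 : 0 < e by rewrite divr_gt0 // subr_gt0.
have eE : d%:R * e + e = \sum_i tnth t i - 1.
  by rewrite -[X in _ + X]mul1r -mulrDl natr1 mulrC divfK // pnatr_eq0.
exists e => // u tu [_ u1].
have : \sum_i (tnth t i - tnth u i) <= \sum_(i < d) e.
  by apply: ler_sum => i _; apply: ltW; apply: le_lt_trans (tu i); rewrite ler_norm.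
rewrite sumrB sumr_const card_ord -mulr_natl; move: u1 eE e0.
by move: (\sum_i tnth t i) (\sum_i tnth u i) (d%:R * e) => x y z; lra.
Qed.

Definition simplex_points (n : nat) : seq Z :=
  [seq [ffun i => (tnth t i : nat)%:Z] |
     t : d.-tuple 'I_n.+1 <- enum [set t : d.-tuple 'I_n.+1 | \sum_(i <- t) i <=
       n]%N%SET].

Lemma mem_simplex_points n z : z \in simplex_points n <->
  (forall i, 0 <= z i) /\ \sum_i z i <= n%:Z.
Proof.
split=> [/mapP[t]|[z0 zn]].
  rewrite mem_enum inE => tn ->; split=> [i|]; first by rewrite ffunE.
  under eq_bigr do rewrite ffunE.
  have -> : \sum_i (tnth t i : nat)%:Z = (\sum_(i < d) tnth t i)%N%:Z.
    by rewrite -[RHS]natz natr_sum; apply: eq_bigr => i _; rewrite natz.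
  by rewrite lez_nat -(big_tuple _ _ t xpredT).
have zi i : (`|z i| < n.+1)%N.
  have : z i <= \sum_i z i by rewrite (bigD1 i) //= lerDl sumr_ge0.
  by have := z0 i; move: zn; lia.
apply/mapP; exists [tuple Ordinal (zi i) | i < d]; last first.
  by apply/ffunP => i; rewrite ffunE tnth_mktuple /=; have := z0 i;
    move: (z i) => y; lia.
rewrite mem_enum inE big_tuple; under eq_bigr do rewrite tnth_mktuple /=.
rewrite -(ler_nat int) natr_sum natz; apply: le_trans zn; apply: ler_sum => i _.
by rewrite natz gez0_abs.
Qed.

Lemma size_simplex_points n : size (simplex_points n) = 'C(d + n, d).
Proof. by rewrite size_map -cardE card_partial_ord_partitions. Qed.

Lemma simplex_points_uniq n : uniq (simplex_points n).
Proof.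
rewrite map_inj_uniq ?enum_uniq // => s t /ffunP st.
by apply: eq_from_tnth => i; apply: val_inj; have := st i; rewrite !ffunE => -[].
Qed.

(** As a function of n, 'C(d + n, d) is a polynomial of degree d with leading
    coefficient 1/d!. *)
Lemma cvg_binomial : ('C(d + n,
  d)%:R / n%:R ^+ d : R) @[n --> \oo] --> (d`!%:R^-1 : R).
Proof.
pose p : {poly R} := \prod_(i < d) ('X - (- (d - i)%N%:R)%:P).
have sp : size p = d.+1 by rewrite size_prod_XsubC /index_enum -enumT size_enum_ord.
have pd : p`_d = 1.
  by have /monicP := monic_prod_XsubC (index_enum 'I_d) xpredT (fun i =>
    - (d - i)%N%:R : R);
    rewrite lead_coefE -/p sp.
have h : (d`!%:R^-1 *: p).[n%:R] / n%:R ^+ d @[n --> \oo] --> (d`!%:R^-1 *: p)`_d.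
  by apply: poly_cvg_coef; rewrite size_scale ?sp // invr_eq0 pnatr_eq0 -lt0n
    fact_gt0.
rewrite coefZ pd mulr1 in h; move: h; apply: cvg_trans; apply: near_eq_cvg.
apply: nearW => n; congr (_ / _); rewrite hornerZ horner_prod.
apply: (@mulfI _ d`!%:R); first by rewrite pnatr_eq0 -lt0n fact_gt0.
rewrite mulrA divff ?mul1r; last by rewrite pnatr_eq0 -lt0n fact_gt0.
rewrite mulrC -natrM bin_ffact ffact_prod natr_prod; apply: eq_bigr => i _.
by rewrite hornerXsubC opprK -natrD; congr (_%:R); have := ltn_ord i; lia.
Qed.

(** The lattice points of the n-fold simplex are counted by 'C(d + n, d). A cube
    on which count and simplex disagree has its corner within d of the facet
    of total n, which the direction (1, ..., 1) crosses once and for all. *)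
Lemma simplex_volume : tuple_lebesgue R d simplex = (d`!%:R^-1)%:E.
Proof.
pose P (n : nat) (z : Z) := \sum_i z i <= n%:Z < \sum_i z i + d%:Z.
have thinP : thin [ffun=> 1] 0 P.
  move=> n z k n0 k0 /andP[_ h] /andP[+ _].
  rewrite (_ : \sum_i _ = \sum_i z i + k%:Z * d%:Z).
    by move: (\sum_i _) h => x; nia.
  under eq_bigr do rewrite ffunE ffunMnE ffunE.
  by rewrite big_split sumr_const card_ord /= -mulr_natr !natz.
have sum_cell n (z : Z) (t : Rn) : (0 < n)%N -> cell n z t ->
    (\sum_i z i)%:~R <= n%:R * \sum_i tnth t i <= (\sum_i z i + d%:Z)%:~R.
  move=> n0 zt; rewrite intrD raddf_sum mulr_sumr /=; apply/andP; split.
    by apply: ler_sum => i _; have /andP[] := zt i.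
  rewrite -pmulrn -[X in _ + X%:R]card_ord -sum1_card natr_sum -big_split /=.
  by apply: ler_sum => i _; have /andP[_ /ltW] := zt i.
have [||||f cv] := @lattice_count_cvg R d simplex_points simplex 1 0 [ffun=> 1] P P
   simplex_points_uniq measurable_simplex thinP thinP.
- move=> n z t n0 /mem_simplex_points[z0 zn] zt nt; left.
  rewrite /P zn /= ltNge; apply/negP => dn; apply: nt; split.
    move=> i; have /andP[zi _] := zt i.
    have : 0 <= n%:R * tnth t i by apply: le_trans zi; rewrite ler0z.
    by rewrite pmulr_rge0 // ltr0n.
  have n0' : 0 < n%:R :> R by rewrite ltr0n.
  rewrite -(ler_pM2l n0') mulr1.
  have /andP[_ h] := sum_cell n z t n0 zt; apply: le_trans h _.
  by rewrite -[n%:R]/(n%:~R) ler_int.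
- move=> n z t n0 zS zt [t0 t1]; left.
  have n0' : 0 < n%:R :> R by rewrite ltr0n.
  have z0 i : 0 <= z i.
    have /andP[_ zi] := zt i.
    have := le_lt_trans (mulr_ge0 (ltW n0') (t0 i)) zi.
    by rewrite -[1]/(1%:~R) -intrD ltr0z ltzD1.
  exfalso; move/negP: zS; apply; apply/mem_simplex_points; split=> //.
  have /andP[h _] := sum_cell n z t n0 zt.
  rewrite -(ler_int R) (le_trans h) // -pmulrn.
  by rewrite -[X in _ <= X]mulr1 ler_wpM2l // ltW.
- move=> n z n0 /mem_simplex_points[z0 zn]; apply/mem_lattice_box => i.
  have : z i <= \sum_i z i by rewrite (bigD1 i) //= lerDl sumr_ge0.
  by move: zn (z0 i); move: (\sum_i _) (z i) => x y; lia.
- move=> n z t n0 zt [t0 t1]; apply/mem_lattice_box => i; rewrite mul1n.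
  have n0' : 0 < n%:R :> R by rewrite ltr0n.
  have /andP[z1 z2] := zt i.
  have ti : tnth t i <= 1.
    by apply: le_trans t1; rewrite (bigD1 i) //= lerDl sumr_ge0.
  have := le_lt_trans (mulr_ge0 (ltW n0') (t0 i)) z2.
  have := le_trans z1 (ler_wpM2l (ltW n0') ti).
  rewrite mulr1 -[1]/(1%:~R) -intrD ltr0z ltzD1 -[n%:R]/(n%:~R) ler_int.
  by move: (z i) => y; lia.
have : ('C(d + n, d)%:R / n%:R ^+ d : R) @[n --> \oo] -->
    fine (tuple_lebesgue R d simplex).
  rewrite (_ : (fun n => _) = (fun n =>
    (size (simplex_points n))%:R / n%:R ^+ d)) //.
  by apply/funext => n; rewrite size_simplex_points.
move=> /(cvg_unique (@norm_hausdorff _ _) cvg_binomial) V.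
by rewrite -(fineK f) -V.
Qed.

End Simplex.

(** * Closure in a finite product of lines *)

Section Closure.
Variables (R : realType) (I : finType).
Implicit Types (x y : I -> R) (A : set (I -> R)).

Definition close (e : R) x y := forall i, `|x i - y i| < e.

Lemma closure_close A x e : 0 < e -> closure A x -> exists2 a, A a & close e x a.
Proof.
move=> e0 /(_ [set y | close e x y])[|a [Aa xa]]; last by exists a.
suff : forall s : seq I, nbhs x [set y | forall i, i \in s -> `|x i - y i| < e].
    move=> /(_ (enum I)); apply: filterS => y xy i; apply: xy.
    by rewrite mem_enum.
elim=> [|j s IH]; first by apply: filterS filterT.
have xj : nbhs x [set y | `|x j - y j| < e].
  exact: (@proj_continuous I (fun=> R) j x _ (nbhsx_ballx (x j) e e0)).
apply: filterS (filterI xj IH) => y [yj ys] i; rewrite inE => /orP[/eqP -> //|].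
exact: ys.
Qed.

(** The neighbourhood filter of x in the product topology is generated by the
    boxes around x, since the index set is finite. *)
Lemma close_closure A x : (forall e : R, 0 < e -> exists2 a, A a & close e x a) ->
  closure A x.
Proof.
move=> xA B nB.
pose F : set_system (I -> R) := [set C | exists2 e : R, 0 < e & close e x `<=` C].
have FF : Filter F.
  split.
  - by exists 1.
  - move=> P Q [e e0 eP] [f f0 fQ]; exists (Num.min e f);
    first by rewrite lt_min e0.
    by move=> y xy; split; [apply: eP|apply: fQ] => i; have := xy i;
      rewrite lt_min => /andP[].
  - by move=> P Q PQ [e e0 eP]; exists e => // y /eP /PQ.
have Fx : F --> x.
  apply/cvg_sup => i; apply/cvg_image.
    apply/seteqP; split=> // r _; exists (fun=> r) => //.
  move=> C /nbhs_ballP[e /= e0 xC].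
  exists [set y | C (y i)]; first by exists e => // y xy; apply: xC; apply: xy.
  by apply/seteqP; split=> [_ [y Cy <-] //|r Cr]; exists (fun=> r).
have [e e0 eB] : F B by apply: Fx.
by have [a Aa xa] := xA e e0; exists a; split=> //; apply: eB.
Qed.

Lemma not_closure_close A x : ~ closure A x ->
  exists2 e : R, 0 < e & forall y, close e x y -> ~ closure A y.
Proof.
move=> nx; apply: contrapT => nex; apply: nx.
have -> : closure A = closure (closure A) by apply/closure_id;
  exact: closed_closure.
apply: close_closure => e e0.
apply: contrapT => na; apply: nex; exists e => // y xy Ay; apply: na.
by exists y.
Qed.
End Closure.

(** * Counting lattice points of the subdiagram part *)

Section Coordinates.
Variables (R : realType) (I : finType) (L : set {ffun I -> int}).
Variable b : seq {ffun I -> int}.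
Hypothesis (L0 : L 0) (bL : is_Zbasis L b).
Local Notation d := (size b).
Local Notation Z := {ffun 'I_d -> int}.

Definition coord_comb (y : 'I_d -> R) : I -> R :=
  lincomb y (fun j : 'I_d => realify R b`_j).

Definition lattice_comb (z : Z) : {ffun I -> int} := \sum_(j < d) b`_j *~ z j.

Lemma realify_lattice_comb z :
  realify R (lattice_comb z) = coord_comb (fun j => (z j)%:~R).
Proof.
apply/funext => e; rewrite /realify sum_ffunE raddf_sum; apply: eq_bigr => j _ /=.
by rewrite ffunMzE intrM mulrC.
Qed.

Lemma lattice_comb_inj : injective lattice_comb.
Proof.
move=> z y zy; have [f [_ fU]] := bL.2 0 L0.
have f0 : f = fun=> 0 by apply: fU; rewrite big1 // => j _; rewrite mulr0z.
have fzy : f = fun j => z j - y j.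
  apply: fU; under eq_bigr do rewrite mulrzBr.
  by rewrite sumrB -!/(lattice_comb _) zy subrr.
apply/ffunP => j; apply/eqP; rewrite -subr_eq0.
by have /(congr1 (fun h => h j)) := fzy; rewrite f0 => <-.
Qed.

Lemma lattice_comb_onto c : L c -> exists z, lattice_comb z = c.
Proof.
move=> /bL.2[f [fc _]]; exists [ffun j => f j]; rewrite fc /lattice_comb.
by apply: eq_bigr => j _; rewrite ffunE.
Qed.

Variable Q : I -> 'I_d -> R.
Hypothesis QP : forall i j : 'I_d, \sum_e realify R b`_i e * Q e j = (i == j)%:R.

Lemma coord_combK y j : \sum_e coord_comb y e * Q e j = y j.
Proof.
rewrite /coord_comb /lincomb; under eq_bigr do rewrite mulr_suml.
rewrite exchange_big (bigD1 j) //= [X in _ + X]big1 ?addr0 => [|i ij].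
  by under eq_bigr do rewrite -mulrA; rewrite -mulr_sumr QP eqxx mulr1.
by under eq_bigr do rewrite -mulrA; rewrite -mulr_sumr QP (negPf ij) mulr0.
Qed.

(** Operator bounds, in the supremum norm, for the passage from coordinates to
    vectors and for the passage back. *)
Definition coord_norm : R := \sum_(j < d) \sum_e `|realify R b`_j e|.
Definition inverse_norm : R := \sum_e \sum_j `|Q e j|.

Lemma coord_norm_ge0 : 0 <= coord_norm. Proof.
by rewrite !sumr_ge0 // => j _; rewrite sumr_ge0. Qed.
Lemma inverse_norm_ge0 : 0 <= inverse_norm. Proof.
by rewrite !sumr_ge0 // => j _; rewrite sumr_ge0. Qed.

Lemma coord_comb_bound y C e : 0 <= C -> (forall j, `|y j| <= C) ->
  `|coord_comb y e| <= C * coord_norm.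
Proof.
move=> C0 yC; apply: le_trans (ler_norm_sum _ _ _) _.
rewrite mulr_sumr; apply: ler_sum => j _; rewrite normrM ler_pM //.
by rewrite (bigD1 e) //= lerDl sumr_ge0.
Qed.

Lemma coord_bound x y C j : 0 <= C -> (forall e, `|x e - y e| <= C) ->
  `|(\sum_e x e * Q e j) - (\sum_e y e * Q e j)| <= C * inverse_norm.
Proof.
move=> C0 xy; rewrite -sumrB; apply: le_trans (ler_norm_sum _ _ _) _.
rewrite mulr_sumr; apply: ler_sum => e _; rewrite -mulrBl normrM ler_pM //.
by rewrite (bigD1 j) //= lerDl sumr_ge0.
Qed.

Lemma coord_combB y y' e : coord_comb y e - coord_comb y' e = coord_comb (fun j
  => y j - y' j) e.
Proof. by rewrite /coord_comb /lincomb -sumrB; apply: eq_bigr => j _;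
  rewrite mulrBl. Qed.

Lemma coord_combZ (c : R) y e : coord_comb (fun j =>
  c * y j) e = c * coord_comb y e.
Proof. by rewrite /coord_comb /lincomb mulr_sumr; apply: eq_bigr => j _;
  rewrite mulrA. Qed.

End Coordinates.

Section Count.
Variables (R : realType) (G : graph).
Local Notation E := (oedge G).
Local Notation H := (homology G).
Local Notation sigma := (cographic_cone R G).
Local Notation g := (generators G).
Local Notation N := (size g).
Local Notation real := (@realify R (oedge G)).
Variable b : seq {ffun E -> int}.
Hypothesis bH : is_Zbasis H b.
Local Notation d := (size b).
Local Notation Z := {ffun 'I_d -> int}.
Local Notation Rn := (d.-tuple (measurableTypeR R)).
Local Notation bf := (@coord_comb R E b).
Local Notation lc := (@lattice_comb E b).

Lemma homology0 : H 0.
Proof. by have := boundaryMn (0 : {ffun E -> int}) 0; rewrite !mulr0n. Qed.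

Lemma lattice_comb_homology (z : Z) : H (lc z).
Proof.
rewrite /homology /= /lattice_comb boundary_sum big1 // => j _.
have -> : b`_j *~ z j = (if 0 <= z j then b`_j *+ `|z j|%N else - (b`_j *+ `|z
  j|%N)).
  by case: (z j) => n; rewrite /= ?mulrNz //.
have bj : boundary b`_j = 0 by apply: (bH.1); apply: mem_nth.
have bMn : boundary (b`_j *+ `|z j|%N) = 0 by rewrite boundaryMn bj mul0rn.
case: ifP => _ //; rewrite -[- _]sub0r boundaryB bMn subr0.
exact: homology0.
Qed.

Lemma sigma_bf y : sigma (bf y) <-> forall e, 0 <= bf y e.
Proof.
split=> [[] //|y0]; split=> //; exists d, y, (fun j : 'I_d => real b`_j);
  split=> // j.
by exists b`_j => //; apply: bH.1; apply: mem_nth.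
Qed.

Lemma sigma_lc (z : Z) : sigma (bf (fun j => (z j)%:~R)) <->
  exists2 s, size s = N & combination g s = lc z.
Proof.
rewrite -realify_lattice_comb; split=> [sz|[s sN <-]]; last first.
  exact: heavy_sigma (combination_heavy R sN).
have : lattice_points H sigma (lc z) by split=> //; apply: lattice_comb_homology.
by move=> /cographic_pointsP[]; apply: circulation_combination.
Qed.

Section WithInverse.
Variable Q : E -> 'I_d -> R.
Hypothesis QP : forall i j : 'I_d, \sum_e real b`_i e * Q e j = (i == j)%:R.

(** A real combination of lattice vectors is a real combination of the basis. *)
Lemma real_homology_bf x : real_homology x -> x = bf (fun j => \sum_e x e * Q e j).
Proof.
suff : real_homology x -> exists y, x = bf y.
  by move=> h /h[y ->]; congr coord_comb; apply/funext => j;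
    rewrite (coord_combK QP).
move=> [n [a [v [vH ->]]]].
have /choice[z zv] : forall i, exists z : Z, v i = bf (fun j => (z j)%:~R).
  move=> i; have [c /(lattice_comb_onto bH)[z <-] <-] := vH i.
  by exists z; rewrite realify_lattice_comb.
exists (fun j => \sum_i a i * (z i j)%:~R); apply/funext => e.
rewrite /lincomb /coord_comb /lincomb.
under [RHS]eq_bigr do rewrite mulr_suml.
rewrite exchange_big; apply: eq_bigr => i _ /=.
by rewrite zv /coord_comb /lincomb mulr_sumr; apply: eq_bigr => j _; rewrite mulrA.
Qed.

Local Notation A := (coord_norm R b).
Local Notation q := (inverse_norm Q).

(** Large enough for the vector that is constantly this number to stay inside
    sigma after a change of its coordinates by less than 3. *)
Definition ones_scale : nat := (Num.truncn (3 * A)).+1.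

Lemma ones_scale_gt : 3 * A < ones_scale%:R.
Proof. by have /truncn_itv/andP[] : 0 <= 3 * A by rewrite mulr_ge0 //
  coord_norm_ge0. Qed.

Variable w : Z.
Hypothesis wE : lc w = ones G *+ ones_scale.

Lemma bfw e : bf (fun j => (w j)%:~R) e = ones_scale%:R.
Proof. by rewrite -realify_lattice_comb /realify wE ffunMnE ffunE natz pmulrn. Qed.

(** The cube with corner z, enlarged by 1 on all sides, to leave room for
    approximating a point of a closure. *)
Definition near_pt (z : Z) (y : 'I_d -> R) :=
  forall j, (z j)%:~R - 1 < y j < (z j)%:~R + 2.

Lemma near_pt_self z : near_pt z (fun j => (z j)%:~R).
Proof. by move=> j; apply/andP; split; lra. Qed.

(** Moving along w raises all coefficients at a steady rate, up to the diameter
    of the enlarged cubes. *)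
Lemma near_shift z k y y' e : near_pt z y -> near_pt (z + w *+ k) y' ->
  bf y e + k%:R * ones_scale%:R - 3 * A <= bf y' e.
Proof.
move=> zy zy'.
have h : `|bf (fun j => y' j - y j - k%:R * (w j)%:~R) e| <= 3 * A.
  apply: coord_comb_bound => // j; have := zy j; have := zy' j.
  rewrite ffunE ffunMnE intrD rmorphMn /= -mulr_natl ler_norml.
  by move=> /andP[? ?] /andP[? ?]; apply/andP; split; lra.
move: h; rewrite -(coord_combB (fun j =>
  y' j - y j)) -coord_combB coord_combZ bfw ler_norml => /andP[h _].
by rewrite lerBlDr -lerBlDl in h *; lra.
Qed.

(** Cubes near the boundary of sigma. *)
Definition straddles_cone (n : nat) (z : Z) :=
  exists y y', [/\ near_pt z y, near_pt z y',
  sigma (bf y) & ~ sigma (bf y')].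

(** Cubes near the layer where phi is between n and n + N. *)
Definition straddles_level (n : nat) (z : Z) :=
  exists y y', [/\ near_pt z y, near_pt z y',
  heavy n%:R (bf y), sigma (bf y') & ~ heavy (n + N)%:R (bf y')].

(** Once the cube at z meets sigma, the cubes further along w lie in sigma. *)
Lemma thin_straddles_cone : thin w N straddles_cone.
Proof.
move=> n z k n0 Nk [y [_ [zy _ sy _]]] [_ [y' [_ zy' _]]]; apply.
apply/sigma_bf => e; apply: le_trans (near_shift e zy zy').
have := sy.2 e; have := ones_scale_gt; have k1 : 1 <= k%:R :> R by rewrite ler1n;
  lia.
have m0 : 0 <= ones_scale%:R :> R by [].
nra.
Qed.

(** The vector w has phi at least 1, so by superadditivity phi has grown past
    n + N after N + 1 steps along w. Here the level n > 0 ensures that the graph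
    has an edge, without which w would vanish. *)
Lemma thin_straddles_level : thin w N straddles_level.
Proof.
move=> n z k n0 Nk [y [_ [zy _ hy _ _]]] [_ [y' [_ zy' _ sy']]]; apply.
have E0 : ones G != 0.
  have [a [a0 _ na]] := hy.
  have [i _] : exists i : 'I_N, true.
    apply: contrapT => /forallNP ni; move: na; rewrite big1 => [|i];
      last by case: (ni i).
    by rewrite lern0 => /eqP n00; rewrite n00 in n0.
  have [e _] := generator_neq0 i.
  by apply/eqP => /ffunP/(_ e); rewrite !ffunE.
have h1 : heavy 1 (real (ones G)).
  apply: lattice_point_heavy => //; apply/cographic_pointsP.
  by split=> [|e]; [exact: boundary_ones|rewrite ffunE].
(* Of the k steps along w, one absorbs the widths of the two cubes and leaves
   the difference x in sigma; the others contribute k - 1 to phi. *)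
pose x e := bf y' e - bf y e - (k.-1 * ones_scale)%:R * real (ones G) e.
have kE : k%:R = k.-1%:R + 1 :> R by rewrite natr1 prednK //; lia.
have o1 e : real (ones G) e = 1 by rewrite /realify ffunE.
have sx : sigma x.
  have xE : x = bf (fun j => y' j - y j - k.-1%:R * (w j)%:~R).
    apply/funext => e; rewrite -(coord_combB (fun j =>
      y' j - y j)) -coord_combB coord_combZ bfw.
    by rewrite /x o1 mulr1 natrM.
  rewrite xE; apply/sigma_bf => e; rewrite -xE /x o1 mulr1 natrM.
  have := near_shift e zy zy'; rewrite kE; have := ones_scale_gt; lra.
have := heavyD (heavyD hy (sigma_heavy sx)) (heavyZ (ler0n R (k.-1 * ones_scale))
  h1).
rewrite (_ : (fun e => _) = bf y'); last first.
  by apply/funext => e; rewrite /x; ring.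
apply: heavy_le; rewrite addr0 mulr1 -natrD ler_nat leq_add2l.
by rewrite (leq_trans _ (leq_pmulr _ _)) //; lia.
Qed.

Definition subdiagram_coords : set Rn :=
  (fun t : Rn => bf (tnth t)) @^-1` Kminus H sigma.

Lemma measurable_subdiagram : measurable subdiagram_coords.
Proof.
apply: measurable_of_open => t /not_closure_close[e e0 eK].
have A1 : 0 < A + 1 by rewrite ltr_wpDl // coord_norm_ge0.
exists (e / (A + 1)) => [|u tu]; first by rewrite divr_gt0.
apply: eK => i; rewrite coord_combB.
have h : `|bf (fun j => tnth t j - tnth u j) i| <= e / (A + 1) * A.
  by apply: coord_comb_bound => [|j]; rewrite ?divr_ge0 // ltW.
apply: le_lt_trans h _; rewrite mulrAC ltr_pdivrMr // ltr_pM2l // ltrDl.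
exact: ltr01.
Qed.

Lemma subdiagram_light t : ~ subdiagram_coords t -> sigma (bf (tnth t)) ->
  heavy 1 (bf (tnth t)).
Proof.
move=> nt st; apply: contrapT => nh; apply: nt.
by apply: subset_closure; split=> // /Kplus_heavy.
Qed.

(** A point of the closure is approximated by points of sigma outside K_+; these
    lie in the span of the lattice, so their coordinates are close as well. *)
Lemma subdiagram_near n t : (0 < n)%N -> subdiagram_coords t ->
  exists s : 'I_d -> R,
  [/\ forall j, `|n%:R * tnth t j - s j| < 1, sigma (bf s) & ~ heavy n%:R (bf s)].
Proof.
move=> n0 Kt; have n0' : 0 < n%:R :> R by rewrite ltr0n.
have q1 : 0 < q + 1 by rewrite ltr_wpDl // inverse_norm_ge0.
have [|a [sa na] ta] := @closure_close R _ _ _ (n%:R * (q + 1))^-1 _ Kt.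
  by rewrite invr_gt0 mulr_gt0.
pose s j := \sum_e a e * Q e j.
have aE : a = bf s by apply: real_homology_bf; case: sa.
exists (fun j => n%:R * s j); split.
- move=> j; rewrite -mulrBr normrM ger0_norm ?ltW // mulrC -ltr_pdivlMr // div1r.
  rewrite -[X in `|X - _|](coord_combK QP (tnth t)).
  apply: le_lt_trans (coord_bound Q j _ (fun e => ltW (ta e))) _.
    by rewrite invr_ge0 mulr_ge0 // ltW.
  rewrite invfM -mulrA gtr_pMr ?invr_gt0 // mulrC ltr_pdivrMr // mul1r ltrDl;
    exact: ltr01.
- apply/sigma_bf => e; rewrite coord_combZ -aE mulr_ge0 //; exact: sa.2.
- move=> h; apply: na; apply: heavy_Kplus.
  have := heavyZ (ltW (_ : 0 < n%:R^-1)) h; rewrite invr_gt0 => /(_ n0').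
  rewrite mulVf ?gt_eqF // (_ : (fun e => _) = a) //.
  by apply/funext => e; rewrite coord_combZ mulrA mulVf ?gt_eqF // mul1r aE.
Qed.

Definition lattice_coord (c : {ffun E -> int}) : Z := xget 0 [set z | lc z = c].

Lemma lattice_coordK c : H c -> lc (lattice_coord c) = c.
Proof. by move=> /(lattice_comb_onto bH)[z zc];
  apply: (@xgetPex _ 0 [set z | lc z = c]); exists z. Qed.

Definition short_points (n : nat) : seq Z :=
  [seq lattice_coord c | c <- short_sums g n].

Lemma short_sums_homology n c : c \in short_sums g n -> H c.
Proof. by move=> /mem_short_sums[[s _ <-] _]; exact: combination_boundary. Qed.

Lemma short_points_uniq n : uniq (short_points n).
Proof.
rewrite map_inj_in_uniq ?short_sums_uniq // =>
  c c' /short_sums_homology Hc /short_sums_homology Hc'.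
by move=> /(congr1 lc); rewrite !lattice_coordK.
Qed.

Lemma mem_short_points n z : z \in short_points n <-> lc z \in short_sums g n.
Proof.
split=> [/mapP[c cS ->]|zS]; first by rewrite lattice_coordK //;
  exact: short_sums_homology cS.
apply/mapP; exists (lc z) => //; apply: (lattice_comb_inj homology0 bH).
by rewrite lattice_coordK //; exact: lattice_comb_homology.
Qed.

Lemma cell_near n z t : cell n z t -> near_pt z (fun j => n%:R * tnth t j).
Proof. by move=> zt j; have /andP[] := zt j => h1 h2; apply/andP; split; lra. Qed.

(** A point outside K_- is outside sigma or in K_+, whereas z is in sigma with
    phi(z) < n + N. *)
Lemma subdiagram_inside n z t : (0 < n)%N -> z \in short_points n -> cell n z t ->
  ~ subdiagram_coords t -> straddles_cone n z \/ straddles_level n z.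
Proof.
move=> n0 /mem_short_points/mem_short_sums[zN zs] zt nt.
have n0' : 0 < n%:R :> R by rewrite ltr0n.
have sz := (sigma_lc z).2 zN.
have ny := cell_near zt.
have [sy|sy] := pselect (sigma (bf (fun j => n%:R * tnth t j))); last first.
  by left; exists (fun j => (z j)%:~R), (fun j => n%:R * tnth t j); split=> //;
    exact: near_pt_self.
right; exists (fun j => n%:R * tnth t j), (fun j => (z j)%:~R); split=> //.
- exact: near_pt_self.
- have st : sigma (bf (tnth t)).
    by apply/sigma_bf => e; have := sy.2 e; rewrite coord_combZ pmulr_rge0.
  have := heavyZ (ltW n0') (subdiagram_light nt st); rewrite mulr1.
  by congr heavy; apply/funext => e; rewrite coord_combZ.
- by rewrite -realify_lattice_comb => /heavy_long_sum.
Qed.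

(** Near a point of K_- there is a point of sigma with phi < n, whereas z is
    outside sigma or a sum of n nonzero elements, with phi(z) >= n. *)
Lemma subdiagram_outside n z t : (0 < n)%N -> z \notin short_points n ->
  cell n z t ->
  subdiagram_coords t -> straddles_cone n z \/ straddles_level n z.
Proof.
move=> n0 /negP nz zt Kt; have [s [ts ss hs]] := subdiagram_near n0 Kt.
have ns : near_pt z s.
  move=> j; have := ts j; rewrite ltr_norml => /andP[s1 s2].
  have /andP[h1 h2] := zt j; apply/andP; split; lra.
have [sz|sz] := pselect (sigma (bf (fun j => (z j)%:~R))); last first.
  by left; exists s, (fun j => (z j)%:~R); split=> //; exact: near_pt_self.
have lz : long_sum g n (lc z).
  apply: contrapT => nl; apply: nz; apply/mem_short_points/mem_short_sums.
  by split=> //; apply/sigma_lc.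
right; exists (fun j => (z j)%:~R), s; split=> //.
- exact: near_pt_self.
- by rewrite -realify_lattice_comb; apply: long_sum_heavy.
- by move=> h; apply: hs; apply: heavy_le h; rewrite ler_nat leq_addr.
Qed.

Definition box_scale : nat := (Num.truncn (2 * q + 1)).+1.

Lemma box_scale_gt : 2 * q + 1 < box_scale%:R.
Proof.
by have /truncn_itv/andP[] : 0 <= 2 * q + 1 by rewrite addr_ge0 // mulr_ge0 //
  inverse_norm_ge0.
Qed.

Lemma mem_scaled_box n (z : Z) : (forall j,
  `|(z j)%:~R| <= (2 * q + 1) * n%:R :> R) ->
  z \in lattice_box d (box_scale * n).
Proof.
move=> zn; apply/mem_lattice_box => j; rewrite -(ler_nat R) natr_absz intr_norm.
apply: le_trans (zn j) _; rewrite natrM ler_wpM2r // ltW //; exact: box_scale_gt.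
Qed.

Lemma short_points_box n z : (0 < n)%N -> z \in short_points n ->
  z \in lattice_box d (box_scale * n).
Proof.
move=> n0 /mem_short_points/mem_short_sums[[s sN sz] zs];
  apply: mem_scaled_box => j.
have sn : (sumn s < n)%N.
  by rewrite ltnNge; apply/negP => ns; apply: zs; exists s.
have : `|\sum_e bf (fun j => (z j)%:~R) e * Q e j - \sum_e 0 * Q e j| <= n%:R * q.
  apply: coord_bound => // e; rewrite subr0 -realify_lattice_comb -sz /realify.
  rewrite ger0_norm ?ler0z ?combination_ge0 // combinationE -[n%:R]/(n%:~R) ler_int.
  apply: (@le_trans _ _ (sumn s)%:Z); last by rewrite lez_nat ltnW.
  rewrite sumnE (big_nth 0%N) big_mkord sN -[X in _ <= X]natz natr_sum.
  by apply: ler_sum => i _; rewrite -[X in X <= _]mulr_natr ler_piMl //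
    generator_le1.
rewrite (coord_combK QP) [X in _ - X]big1 => [|e _]; last by rewrite mul0r.
rewrite subr0 => h; apply: le_trans h _; have := inverse_norm_ge0 Q;
  have : 0 <= n%:R :> R by [].
nra.
Qed.

Lemma subdiagram_box n z t : (0 < n)%N -> cell n z t -> subdiagram_coords t ->
  z \in lattice_box d (box_scale * n).
Proof.
move=> n0 zt Kt; apply: mem_scaled_box => j;
  have n0' : 0 < n%:R :> R by rewrite ltr0n.
have te e : `|bf (tnth t) e - 0| <= 2.
  have [a [sa na] /(_ e)] := closure_close ltr01 Kt.
  have : a e <= 1 by apply: light_le1 => // /heavy_Kplus.
  have := sa.2 e; rewrite subr0 ltr_norml ler_norml => ? ? /andP[? ?].
  by apply/andP; split; lra.
have := coord_bound Q j (ler0n R 2) te;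
  rewrite (coord_combK QP) [X in _ - X]big1 => [|e _]; last by rewrite mul0r.
rewrite subr0 => tj; have /andP[h1 h2] := zt j.
have : `|n%:R * tnth t j| <= n%:R * (2 * q) by rewrite normrM (ger0_norm (ltW
  n0')) ler_wpM2l // ltW.
have n1 : 1 <= n%:R :> R by rewrite ler1n.
by rewrite !ler_norml => /andP[? ?]; apply/andP; split; lra.
Qed.

Lemma short_points_cvg : tuple_lebesgue R d subdiagram_coords \is a fin_num /\
  (size (short_sums g n))%:R / n%:R ^+ d @[n --> \oo] -->
    fine (tuple_lebesgue R d subdiagram_coords).
Proof.
have := @lattice_count_cvg R d short_points subdiagram_coords box_scale N w
  straddles_cone straddles_level
  short_points_uniq measurable_subdiagram thin_straddles_cone thin_straddles_level
  subdiagram_inside subdiagram_outside short_points_box subdiagram_box.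
rewrite (_ : (fun n => (size (short_points n))%:R / _) =
             (fun n => (size (short_sums g n))%:R / n%:R ^+ d)) //.
by apply/funext => n; rewrite size_map.
Qed.

(** phi is bounded on the cube with corner w. Shrinking this cube by a factor n
    beyond that bound brings it into sigma outside K_+. *)
Lemma subdiagram_volume_gt0 : (0 < tuple_lebesgue R d subdiagram_coords)%E.
Proof.
(* phi is at most the sum of all coefficients, so a larger level is missed. *)
pose n := (Num.truncn (\sum_(e : E) (ones_scale%:R + A))).+1.
have nE : \sum_(e : E) (ones_scale%:R + A) < n%:R.
  have /truncn_itv/andP[] // : 0 <= \sum_(e : E) (ones_scale%:R + A).
  by rewrite sumr_ge0 // => e _; rewrite addr_ge0 // coord_norm_ge0.
have n0' : 0 < n%:R :> R by rewrite ltr0n.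
have wK : cell n w `<=` subdiagram_coords.
  move=> t wt; have te e : `|bf (fun j => n%:R * tnth t j) e - ones_scale%:R| <= A.
    rewrite -(bfw e) coord_combB -[A]mul1r; apply: coord_comb_bound => // j.
    by have /andP[h1 h2] := wt j; rewrite ler_norml; apply/andP; split; lra.
  apply: subset_closure; split.
    apply/sigma_bf => e; have := te e; rewrite coord_combZ ler_norml => /andP[h _].
    have : 0 <= n%:R * bf (tnth t) e by have := ones_scale_gt;
      have := coord_norm_ge0 R b; lra.
    by rewrite pmulr_rge0.
  move=> /Kplus_heavy/(heavyZ (ltW n0')); rewrite mulr1 => /heavy_sum_ge.
  apply/negP; rewrite -ltNge; apply: le_lt_trans nE; apply: ler_sum => e _.
  by have := te e; rewrite coord_combZ ler_norml => /andP[_]; lra.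
apply: (@lt_le_trans _ _ (tuple_lebesgue R d (cell n w))).
  by rewrite measure_cell // lte_fin invr_gt0 exprn_gt0.
by apply: le_measure; rewrite ?inE //;
  [apply: measurable_cell|apply: measurable_subdiagram].
Qed.

End WithInverse.
End Count.

(** * The Hilbert-Samuel polynomial and the multiplicity *)

Section HilbertSamuel.
Variables (R : realType) (k : fieldType) (G : graph).
Local Notation E := (oedge G).
Local Notation S := (cographic_semigroup R G).
Local Notation g := (generators G).
Local Notation N := (size g).

Lemma semigroupP (c : S) : boundary (sval c) = 0 /\ forall e, 0 <= sval c e.
Proof. by have /set_mem/cographic_pointsP := valP c. Qed.

Lemma semigroup_combination (c : S) : exists2 s,
  size s = N & combination g s = sval c.
Proof. by have [] := semigroupP c; apply: circulation_combination. Qed.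

Lemma combination_point s : combination g s \in
  lattice_points (homology G) (cographic_cone R G).
Proof.
apply/mem_set/cographic_pointsP; split; first exact: combination_boundary.
by move=> e; exact: combination_ge0.
Qed.

Definition combination_semigroup s : S :=
  exist (fun z => z \in lattice_points (homology G) (cographic_cone R G))
    (combination g s) (combination_point s).

Definition total_degree (c : S) : nat := (\sum_e `|sval c e|)%N.

Lemma total_degreeM (c c' : S) : total_degree (mmul c c') = (total_degree c +
  total_degree c')%N.
Proof.
rewrite /total_degree -big_split; apply: eq_bigr => e _ /=; rewrite ffunE.
have := (semigroupP c).2 e; have := (semigroupP c').2 e.
by move: (sval c e) (sval c' e) => x y; lia.
Qed.

Lemma total_degree_gt0 (c : S) : c != mone -> (0 < total_degree c)%N.
Proof.
rewrite lt0n; apply: contraNneq => /eqP; rewrite sum_nat_eq0 => /forallP c0.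
apply/eqP/val_inj/ffunP => e /=; rewrite ffunE.
by have := c0 e; rewrite /= absz_eq0 => /eqP.
Qed.

(** A nontrivial factor is a nonempty sum of generators; conversely one
    generator can be split off from a nonempty sum. *)
Lemma factors_long_sum n (c : S) : factors n c <-> long_sum g n (sval c).
Proof.
split.
  elim: n c => [|n IH] c.
    by move=> _; have [s sN sc] := semigroup_combination c; exists s.
  move=> [x [y [x1 /IH[t [tN ty nt]] ->]]].
  have [s sN sx] := semigroup_combination x.
  exists (addseq s t); rewrite size_addseq ?sN // combinationD ?sN ?tN // sx ty.
  split=> //; rewrite sumn_addseq ?sN ?tN // -addn1 addnC leq_add // lt0n.
  apply: contraNneq x1 => s0; apply/eqP/val_inj; change (sval x = 0).
  rewrite -sx /combination big1 // => i _.
  have : all (pred1 0%N) s.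
    by elim: s s0 {sN sx} => //= a s IHs /eqP;
      rewrite addn_eq0 => /andP[-> /eqP/IHs].
  by move=> /(all_nthP 0%N)/(_ i); rewrite sN => /(_ (ltn_ord i))/eqP ->;
    rewrite mulr0n.
move=> [s [sN sc ns]]; elim: n c s sN sc ns => [//|n IH] c s sN sc ns.
have [i si] : exists i : 'I_N, (0 < nth 0%N s i)%N.
  apply: contrapT => /forallNP s0; move: ns;
    rewrite sumnE (big_nth 0%N) big_mkord sN.
  by rewrite big1 // => i _; apply/eqP; rewrite -leqn0 leqNgt; apply/negP/s0.
pose u := mkseq (fun j => (i == j :> nat) : nat) N.
have us : all2 leq u s.
  rewrite all2E size_mkseq sN eqxx /=; apply/(all_nthP (0, 0)%N) => j.
  rewrite size_zip size_mkseq sN minnn => jN;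
    rewrite nth_zip ?size_mkseq // nth_mkseq //=.
  by case: eqP => // <-.
have [t [ut st]] := all2_leq_addseq us.
have tN : size t = N by rewrite -ut size_mkseq.
pose x := combination_semigroup u; pose y := combination_semigroup t.
have ue : combination g u = g`_i := combination_unit i.
exists x, y; split.
- have [e ge] := generator_neq0 i;
  apply/eqP => /(congr1 (fun z : S => sval z e)) /=.
  by rewrite ue ge ffunE.
- apply: (IH y t) => //; move: ns;
  rewrite st sumn_addseq // (sumn_unit i) addnC addn1.
  by rewrite ltnS.
- by apply: val_inj; rewrite /= -sc st combinationD.
Qed.

Lemma cographic_quotient_length n : quotient_length
  (ideal_pow (@nonunits (localization (origin R k G))) n) (size (short_sums g n)).
Proof.
pose L : seq S := pmap insub (short_sums g n).
have short_point c : c \in short_sums g n -> c \in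
    lattice_points (homology G) (cographic_cone R G).
  by move=> /mem_short_sums[[s _ <-] _]; exact: combination_point.
have -> : size (short_sums g n) = size L.
  rewrite size_pmap_sub; apply/esym/eqP; rewrite -all_count; exact/allP.
have pE f : (f \in (origin R k G : pred _)) = (mcoeff mone f == 0) by [].
apply: (quotient_length_monom total_degreeM total_degree_gt0 pE).
  by apply: pmap_sub_uniq; apply: short_sums_uniq.
move=> c; rewrite mem_pmap_sub factors_long_sum; split=> [/mem_short_sums[]//|nc].
by apply/mem_short_sums; split=> //; exact: semigroup_combination.
Qed.

Lemma quotient_length_unique (O : comNzRingType) (J : set O) l l' :
  quotient_length J l -> quotient_length J l' -> l = l'.
Proof.
move=> [[I Il] lmax] [[I' Il'] lmax']; apply/eqP; rewrite eqn_leq.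
by rewrite (lmax' _ _ Il) (lmax _ _ Il').
Qed.

(** A Hilbert-Samuel polynomial exists by [eventually_poly_short_sums], and the
    defining property of the chosen one already determines its values at
    large n. *)
Lemma hilbert_samuel_short_sums : exists n0, forall n, (n0 <= n)%N ->
  (hilbert_samuel_poly (localization (origin R k G))).[n%:R] =
  (size (short_sums g n))%:R.
Proof.
rewrite /hilbert_samuel_poly; set HS := [set P | _].
have [P [n0 HP]] := eventually_poly_short_sums g.
have HSP : HS P.
  exists n0 => // n /= n0n; exists (size (short_sums g n)); last by rewrite HP.
  exact: cographic_quotient_length.
have [n1 _ H1] : HS (xget 0 HS) by apply: xgetPex; exists P.
exists n1 => n n1n; have [l Hl ->] := H1 n n1n.
by rewrite (quotient_length_unique Hl (cographic_quotient_length n)).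
Qed.

End HilbertSamuel.

(** Coordinates with respect to b are linear on vectors and are nonnegative with
    sum at most 1 on 0 and on the members of b, hence on their convex hull. *)
Lemma basis_simplex (R : realType) (I : finType) (L : set {ffun I -> int}) b :
  L 0 -> is_Zbasis L b ->
  @basis_comb R I b @^-1` convex_hull (@realify R I @` (0 |` [set` b])) =
  @simplex R (size b).
Proof.
move=> L0 bL; have [Q QP] := Zbasis_right_inverse R L0 bL.
apply/seteqP; split=> [t [n [a [v [vb a0 a1 tE]]]]|t [t0 t1]].
  have tj j : tnth t j = \sum_i a i * (\sum_e v i e * Q e j).
    rewrite -(coord_combK QP (tnth t) j) [coord_comb _]tE /lincomb.
    under eq_bigr do rewrite mulr_suml.
    rewrite exchange_big; apply: eq_bigr => i _ /=.
    by rewrite mulr_sumr; apply: eq_bigr => e _; rewrite mulrA.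
  have vj i : (forall j, 0 <= \sum_e v i e * Q e j) /\
      \sum_j (\sum_e v i e * Q e j) <= 1.
    have [z [->|/(nthP 0)[l lb <-]] <-] := vb i.
      have z0 j : \sum_e realify R (0 : {ffun I -> int}) e * Q e j = 0.
        by rewrite big1 // => e _; rewrite /realify ffunE mul0r.
      by split=> [j|]; [rewrite z0|rewrite big1].
    have E j := QP (Ordinal lb) j; rewrite /= in E; split=> [j|];
      first by rewrite E.
    under eq_bigr do rewrite E.
    by rewrite (bigD1 (Ordinal lb)) //= eqxx big1 ?addr0 // => j;
      rewrite eq_sym => /negPf ->.
  split=> [j|]; first by rewrite tj sumr_ge0 // => i _;
    rewrite mulr_ge0 // (vj i).1.
  under eq_bigr do rewrite tj.
  rewrite exchange_big -a1 /=; apply: ler_sum => i _; rewrite -mulr_sumr.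
  by rewrite ler_piMr // (vj i).2.
exists (size b).+1.
exists (fun j => if unlift ord0 j is Some i then tnth t i else 1 - \sum_i tnth t i).
exists (fun j => if unlift ord0 j is Some i then realify R b`_i else realify R 0).
split.
- move=> j; case: unliftP => [i _|_]; last by exists 0 => //; left.
  by exists b`_i => //; right; rewrite /= mem_nth.
- by move=> j; case: unliftP => [i _|_] //; rewrite subr_ge0.
- rewrite big_ord_recl unlift_none; under [X in _ + X]eq_bigr do rewrite liftK.
  by rewrite subrK.
- apply/funext => e; rewrite /basis_comb /lincomb big_ord_recl unlift_none.
  have -> : realify R (0 : {ffun I -> int}) e = 0 by rewrite /realify ffunE.
  rewrite mulr0 add0r; apply: eq_bigr => i _.
  by rewrite liftK.
Qed.

Theorem theorem4p11 (R : realType) (k : fieldType) (G : graph) :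
  (ratr (mult_at (origin R k G)))%:E =
  subdiagram_volume (homology G) (cographic_cone R G).
Proof.
rewrite /subdiagram_volume span_lattice_homology /lattice_volume.
set b := Zbasis (homology G).
have bH : is_Zbasis (homology G) b.
  have : [set c | is_Zbasis (homology G) c] b.
    by apply: xgetPex; exact: homology_Zbasis.
  by [].
have H0 := homology0 G.
rewrite /= (basis_simplex R H0 bH) simplex_volume.
have [Q QP] := Zbasis_right_inverse R H0 bH.
have Hones : homology G (ones G *+ ones_scale R b).
  by rewrite /homology /= boundaryMn boundary_ones mul0rn.
have [w wE] := lattice_comb_onto bH Hones.
have [Vfin Vcvg] := short_points_cvg bH QP wE.
have V0 := subdiagram_volume_gt0 bH wE.
have -> : basis_comb (b:=b) @^-1` Kminus (homology G) (cographic_cone R G) =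
   @subdiagram_coords R G b by [].
set V := tuple_lebesgue _ _ _ in Vfin Vcvg V0 *.
set HS := hilbert_samuel_poly (localization (origin R k G)).
have [n0 HSn] := hilbert_samuel_short_sums R k G.
pose P := map_poly (@ratr R) HS.
have PV : P.[n%:R] / n%:R ^+ size b @[n --> \oo] --> fine V.
  move: Vcvg; apply: cvg_trans; apply: near_eq_cvg; exists n0 => // n /= n0n.
  by rewrite -(ratr_nat _ n) horner_map /= HSn // !ratr_nat.
have V0' : fine V != 0 by rewrite gt_eqF // fine_gt0 // V0 ltey_eq Vfin.
have [sP lP] := poly_of_cvg V0' PV.
rewrite /mult_at /multiplicity -/HS.
rewrite size_map_poly in sP; rewrite lead_coef_map /= in lP.
rewrite sP /= rmorphM /= lP ratr_nat -(fineK Vfin) inver.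
have f0 : (size b)`!%:R != 0 :> R by rewrite pnatr_eq0 -lt0n fact_gt0.
by rewrite invr_eq0 (negPf f0) invrK -EFinM mulrC.
Qed.
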